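(* Assume that $F$ is $\mu$-strongly convex with $\mu>0$, that $f(\cdot;\xi)$ is $L$-smooth for every realization of $\xi$ (the functions $f(\cdot;\xi)$ need not be convex), and that the shared memory is consistent with (constant) delay $\tau$. Let $w_*$ be the unique minimizer of $F$ and $\kappa=\frac{L}{\mu}$. Consider the Hogwild! general recursion $$w_{t+1}=w_t-\eta_td_{\xi_t}S^{\xi_t}_{u_t}\nabla f(\hat w_t;\xi_t),\qquad t\ge0,$$ with filter parameter $D$ and with stepsizes satisfying $$0<\eta_t=\frac{1}{LD\kappa(2+\beta)(k+t)}\quad(t\ge0),\qquad\beta>0,\quad k\ge3\tau.$$ Then, with probability one, $\|w_t-w_*\|\to0$ as $t\to\infty$.
   Context: Problem: $\xi$ is a random variable, $f(\cdot;\xi):\mathbb{R}^d\to\mathbb{R}$ is differentiable for every realization, $F(w)=\mathbb{E}[f(w;\xi)]$ and $\mathbb{E}[\nabla f(w;\xi)]=\nabla F(w)$ for every $w$. Norms are Euclidean. $\mu$-strong convexity: $F(w)-F(w')\ge\langle\nabla F(w'),w-w'\rangle+\frac{\mu}{2}\|w-w'\|^2$ for all $w,w'$. $L$-smoothness ($L>0$ uniform in $\xi$): $\|\nabla f(w;\xi)-\nabla f(w';\xi)\|\le L\|w-w'\|$ for all $w,w'$. The quantity $N=2\mathbb{E}[\|\nabla f(w_*;\xi)\|^2]$ is finite. Filters: $D_\xi\subseteq\{1,\dots,d\}$ is the set of positions $i$ for which there is some $w$ with $[\nabla f(w;\xi)]_i\neq0$; $D_\xi$ also denotes the diagonal 0/1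 matrix with ones exactly at these positions, and $|D_\xi|$ the number of ones. A positive integer $D$ is fixed. For each $\xi$, non-zero diagonal 0/1 matrices $S^\xi_u$ are fixed with $\sum_uS^\xi_u=D_\xi$, each having $\lfloor|D_\xi|/D\rfloor$ or $\lceil|D_\xi|/D\rceil$ ones on its diagonal; there are $D$ of them if $D\le|D_\xi|$, and $|D_\xi|$ of them (each with a single one) if $D>|D_\xi|$. The number of matrices $S^\xi_u$ is denoted $d_\xi$. Given $\xi_t$, the index $u_t$ is chosen uniformly at random among the $d_{\xi_t}$ indices, so that $d_\xi\mathbb{E}[S^\xi_u\mid\xi]=D_\xi$. Delay: $\hat w_t$ is the (possibly inconsistently) read vector. Shared memory is consistent with delay $\tau$ if for all $t$ the vector $\hat w_t$ includes all updates made up to and including the $(t-\tau)$-th iteration, plus some subset of the single-position updates made in later iterations up to the $t$-th; that is, $$\hat w_t=w_{t-\tau}-\sum_{j=t-\tau}^{t-1}\eta_jd_{\xi_j}\Sigma_{t,j}S^{\xi_j}_{u_j}\nabla f(\hat w_j;\xi_j)$$ for some (possibly random) diagonal 0/1 matrices (masks) $\Sigma_{t,j}$, where $t-\tau$ is read as $\max\{t-\tau,0\}$. Let $\mathcal{F}_t$ be the $\sigma$-algebra generated by $w_0$ and all $\xi_j,u_j$ with $j\le t-1$ and all masks $\Sigma_{s,j}$ with $s\le t$ (so $w_t,\hat w_t$ are $\mathcal{F}_t$-measurable). The $\xi_t$ are i.i.d. copies of $\xi$, $(\xi_t,u_t)$ is independent of $\mathcal{F}_t$, $w_0$ is a given point,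 and the stepsizes are deterministic. *)

(* Defs.v *)
From HB Require Import structures.
From mathcomp Require Import all_boot all_order all_algebra finmap.
From mathcomp Require Import all_classical all_reals all_analysis.
Set Implicit Arguments.
Unset Strict Implicit.
Unset Printing Implicit Defensive.
Import Order.TTheory GRing.Theory Num.Theory.
Import numFieldNormedType.Exports.

Local Open Scope classical_set_scope.
Local Open Scope ring_scope.

(* The library norm on matrices is the sup norm; it induces the same topology
   (hence the same notion of differentiability) as the Euclidean norm. *)
Definition enorm (R : realType) (d : nat) (v : 'cV[R]_d) : R :=
  Num.sqrt (\sum_(i < d) v i 0 ^+ 2).

Definition inner (R : realType) (d : nat) (v v' : 'cV[R]_d) : R :=
  \sum_(i < d) v i 0 * v' i 0.

(* This is the gradient only where g is [differentiable]; everything below is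
   used together with that hypothesis. *)
Definition grad (R : realType) (d : nat) (g : 'cV[R]_d -> R) (w : 'cV[R]_d) :
    'cV[R]_d :=
  \col_(i < d) 'D_(delta_mx i 0) g w.

Definition strongly_convex (R : realType) (d : nat) (mu : R)
    (F : 'cV[R]_d -> R) : Prop :=
  forall w w' : 'cV[R]_d,
    F w - F w' >= inner (grad F w') (w - w') + mu / 2 * enorm (w - w') ^+ 2.

Definition smooth (R : realType) (d : nat) (L : R) (g : 'cV[R]_d -> R) : Prop :=
  forall w w' : 'cV[R]_d, enorm (grad g w - grad g w') <= L * enorm (w - w').

Definition unique_minimizer (R : realType) (d : nat) (F : 'cV[R]_d -> R)
    (w : 'cV[R]_d) : Prop :=
  forall w' : 'cV[R]_d, w' != w -> F w < F w'.

(* A diagonal 0/1 matrix is given by the set A of positions of its ones. *)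
Definition mask_mx (R : realType) (d : nat) (A : {set 'I_d}) : 'M[R]_d :=
  diag_mx (\row_(i < d) (i \in A)%:R).

Section Filters.
Context (R : realType) (d : nat) (X : Type) (f : 'cV[R]_d -> X -> R).
Variables (D : nat) (S : X -> nat -> {set 'I_d}).

Definition Dset (x : X) : {set 'I_d} :=
  [set i | `[< exists w : 'cV[R]_d, grad (f ^~ x) w i 0 != 0 >]]%SET.

Definition nfilters (x : X) : nat :=
  if (D <= #|Dset x|)%N then D else #|Dset x|.

(* The filters at x are the S x n with n < nfilters x (other values of S x are
   irrelevant). The two admissible sizes are the floor and the ceiling of
   #|Dset x| / D; when D > #|Dset x| they are 0 and 1 (at most), so that the
   nonzero filters have a single one. *)
Definition filters : Prop := forall x : X,
  [/\ \sum_(n < nfilters x) mask_mx R (S x n) = mask_mx R (Dset x),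
      forall n, (n < nfilters x)%N -> S x n != finset.set0 &
      forall n, (n < nfilters x)%N ->
        #|S x n| = (#|Dset x| %/ D)%N \/
        #|S x n| = ((#|Dset x| + D.-1) %/ D)%N].

End Filters.

Definition integrableRV (dO : measure_display) (Omega : measurableType dO)
    (R : realType) (P : probability Omega R) (Y : Omega -> R) : Prop :=
  P.-integrable setT (EFin \o Y).

Definition independent_classes (dO : measure_display)
    (Omega : measurableType dO) (R : realType) (P : probability Omega R)
    (G H : set_system Omega) : Prop :=
  forall A B, G A -> H B -> P (A `&` B) = (P A * P B)%E.

Definition mutually_independent (dO dX : measure_display)
    (Omega : measurableType dO) (X : measurableType dX) (R : realType)
    (P : probability Omega R) (Y : nat -> Omega -> X) : Prop :=
  forall (J : {fset nat}) (A : nat -> set X), (forall j, measurable (A j)) ->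
    P (\bigcap_(j in [set` J]) Y j @^-1` A j) =
    (\prod_(j <- J) P (Y j @^-1` A j))%E.

Section Process.
Context (dO dX : measure_display) (Omega : measurableType dO)
  (X : measurableType dX) (R : realType) (P : probability Omega R) (d : nat).
Variables (xi : nat -> Omega -> X) (u : nat -> Omega -> nat).
Variable Sigma : nat -> nat -> Omega -> {set 'I_d}.

(* The masks Sigma s j that occur are those with s - tau <= j < s (truncated
   subtraction). The initial point is deterministic, hence generates nothing. *)
Definition history (tau t : nat) : set_system Omega :=
  <<s [set E | (exists j (A : set X),
                  [/\ (j < t)%N, measurable A & E = xi j @^-1` A])
            \/ (exists j (A : set nat), (j < t)%N /\ E = u j @^-1` A)
            \/ (exists s j (A : set {set 'I_d}),
                  [/\ (s <= t)%N, (s - tau <= j < s)%N &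
                      E = Sigma s j @^-1` A]) ] >>.

Definition pair_sigma_algebra (t : nat) : set_system Omega :=
  preimage_set_system setT (fun om => (xi t om, u t om)) measurable.

(* Given xi_t, the index u_t is uniform on {0, ..., m xi_t - 1}. When
   m xi_t = 0 there is no index to choose and nothing is required of u_t. *)
Definition conditionally_uniform (m : X -> nat) (t : nat) : Prop :=
  forall (A : set X) (n j : nat), measurable A -> (j < n)%N ->
    P [set om | [/\ A (xi t om), m (xi t om) = n & u t om = j]] =
    ((n%:R^-1)%:E * P [set om | A (xi t om) /\ m (xi t om) = n])%E.

End Process.

Section Hogwild.
Context (Omega X : Type) (R : realType) (d : nat) (f : 'cV[R]_d -> X -> R).
Variables (D : nat) (S : X -> nat -> {set 'I_d}) (eta : nat -> R).
Variables (xi : nat -> Omega -> X) (u : nat -> Omega -> nat).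
Variables (w what : nat -> Omega -> 'cV[R]_d).

Definition filtered_step (t : nat) (om : Omega) : 'cV[R]_d :=
  (eta t * (nfilters f D (xi t om))%:R) *:
    (mask_mx R (S (xi t om) (u t om)) *m
       grad (f ^~ (xi t om)) (what t om)).

Definition hogwild_recursion : Prop :=
  forall (t : nat) (om : Omega), w t.+1 om = w t om - filtered_step t om.

(* Truncated subtraction renders the convention max {t - tau, 0}. *)
Definition consistent_with_delay (tau : nat)
    (Sigma : nat -> nat -> Omega -> {set 'I_d}) : Prop :=
  forall (t : nat) (om : Omega),
    what t om = w (t - tau)%N om -
      \sum_(t - tau <= j < t) mask_mx R (Sigma t j om) *m filtered_step j om.

End Hogwild.

(* Main.v *)
Require Import Defs.
From HB Require Import structures.
From mathcomp Require Import all_boot all_order all_algebra finmap.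
From mathcomp Require Import all_classical all_reals all_analysis.
From mathcomp Require Import measurable_realfun zify ring lra.
Set Implicit Arguments.
Unset Strict Implicit.
Unset Printing Implicit Defensive.
Import Order.TTheory GRing.Theory Num.Theory.
Import numFieldNormedType.Exports.
Local Open Scope classical_set_scope.
Local Open Scope ring_scope.

(* Write V_t = |w_t - w*|^2 and a_t = |hat w_t - w*|^2. Conditionally on the
   past, strong convexity, Lipschitz continuity of grad F, Young's inequality
   and d_xi E[S_u | xi] = D_xi give
     E[V_(t+1) | F_t] <= V_t - eta_t (mu / 2) a_t + C eta_t |w_t - hat w_t|^2
                         + C eta_t^2 (a_t + 1),
   and |w_t - hat w_t|^2 is at most tau times the sum of the last tau squared
   increments, hence of order eta^2 (1 + a) in mean. Summing over t, the
   negative terms absorb the delays, so that both sum eta_t E V_t and the total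
   expected perturbation sum_t E e_t are finite, where E[V_(t+1) | F_t] <=
   V_t + e_t for large t. As sum eta_t diverges, E V_T is small for some
   arbitrarily large T, and Doob's maximal inequality for the almost
   supermartingale (V_t)_(t >= T) bounds P(sup_(t >= T) V_t >= e) by
   (E V_T + sum_(t >= T) E e_t) / e. No martingale convergence is needed.
   Conditional expectations given the past are replaced by Tonelli's theorem for
   the law of the independent pair (past, (xi_t, u_t)). *)

(** * Freezing an independent variable *)

(** Freezing the past requires the update to be jointly measurable in the past and the fresh pair,
    while measurability of [f v] is given for each fixed [v]. Lipschitz gradients bridge this gap: a
    function that is Lipschitz in its parameter is a limit of functions whose parameter takes
    countably many values. Strong convexity is used at the read vector hat w_t, where the gradient
    is evaluated, so the drift controls a_t rather than V_t, and the two are compared through the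
    delay error. The perturbations e_t are random, but their means are deterministic and summable,
    which is what the maximal inequality asks for. *)

Definition mfun_of (d1 d2 : measure_display) (T1 : measurableType d1)
    (T2 : measurableType d2) (g : T1 -> T2) (mg : measurable_fun setT g) :
    {mfun T1 >-> T2} :=
  HB.pack g (isMeasurableFun.Build _ _ _ _ _ mg).

(** Agreement on rectangles identifies the law of the pair with the product of the marginals. The
    inner integral, with [f1 om] frozen, plays the role of the conditional expectation given
    [f1]. *)
Lemma independent_ge0_integral (dO d1 d2 : measure_display)
    (Omega : measurableType dO) (T1 : measurableType d1)
    (T2 : measurableType d2) (R : realType) (P : probability Omega R)
    (f1 : {RV P >-> T1}) (f2 : {RV P >-> T2}) (phi : T1 * T2 -> \bar R) :
  (forall A B, measurable A -> measurable B ->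
    P (f1 @^-1` A `&` f2 @^-1` B) = (P (f1 @^-1` A) * P (f2 @^-1` B))%E) ->
  measurable_fun setT phi -> (forall z, 0 <= phi z)%E ->
  (\int[P]_om phi (f1 om, f2 om) =
   \int[P]_om \int[P]_om' phi (f1 om, f2 om'))%E.
Proof.
move=> indep mphi phi0.
have mf12 : measurable_fun setT (fun om => (f1 om, f2 om)).
  exact: measurable_fun_pair.
pose m' := distribution P (mfun_of mf12).
have -> : (\int[P]_om phi (f1 om, f2 om) = \int[m']_z phi z)%E.
  by rewrite ge0_integral_pushforward.
transitivity (\int[distribution P f1 \x distribution P f2]_z phi z)%E.
  apply: eq_measure_integral => A mA _; apply/esym.
  by apply: product_measure_unique => //.
rewrite fubini_tonelli1// ge0_integral_distribution/=.
- apply: eq_integral => om _ /=; rewrite /fubini_F ge0_integral_distribution//.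
  exact: measurableT_comp.
- exact: measurable_fun_fubini_tonelli_F.
- by move=> y; apply: integral_ge0.
Qed.

Lemma measurable_fun_integral_freeze (dO d1 d2 : measure_display)
    (Omega : measurableType dO) (T1 : measurableType d1)
    (T2 : measurableType d2) (R : realType) (P : probability Omega R)
    (f2 : {RV P >-> T2}) (phi : T1 * T2 -> \bar R) :
  measurable_fun setT phi -> (forall z, 0 <= phi z)%E ->
  measurable_fun setT (fun x => \int[P]_om' phi (x, f2 om'))%E.
Proof.
move=> mphi phi0.
have := measurable_fun_fubini_tonelli_F (m2 := distribution P f2) phi mphi phi0.
apply: eq_measurable_fun => x _; rewrite /fubini_F.
by rewrite ge0_integral_distribution//; exact: measurableT_comp.
Qed.

(** * Squared Euclidean norm and joint measurability *)

Definition nsq (R : realType) (d : nat) (v : 'cV[R]_d) : R :=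
  \sum_(i < d) v i 0 ^+ 2.

Section Nsq.
Context (R : realType) (d : nat).
Implicit Types (v w : 'cV[R]_d) (c : R).

Lemma nsq_ge0 v : 0 <= nsq v.
Proof. by apply: sumr_ge0 => i _; exact: sqr_ge0. Qed.

Lemma sqr_enorm v : enorm v ^+ 2 = nsq v.
Proof. by rewrite /enorm sqr_sqrtr// nsq_ge0. Qed.

Lemma innerC v w : inner v w = inner w v.
Proof. by apply: eq_bigr => i _; rewrite mulrC. Qed.

Lemma innerDl v v' w : inner (v + v') w = inner v w + inner v' w.
Proof. by rewrite -big_split; apply: eq_bigr => i _ /=; rewrite mxE mulrDl. Qed.

Lemma innerZl c v w : inner (c *: v) w = c * inner v w.
Proof. by rewrite /inner mulr_sumr; apply: eq_bigr => i _; rewrite mxE mulrA. Qed.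

Lemma innerNl v w : inner (- v) w = - inner v w.
Proof. by rewrite -scaleN1r innerZl mulN1r. Qed.

Lemma innerBl v v' w : inner (v - v') w = inner v w - inner v' w.
Proof. by rewrite innerDl innerNl. Qed.

Lemma inner_nsq v : inner v v = nsq v.
Proof. by apply: eq_bigr => i _; rewrite expr2. Qed.

Lemma inner0r v : inner v 0 = 0.
Proof. by rewrite /inner big1// => i _; rewrite mxE mulr0. Qed.

Lemma nsq0 : nsq (0 : 'cV[R]_d) = 0.
Proof. by rewrite -inner_nsq inner0r. Qed.

Lemma nsqD v w : nsq (v + w) = nsq v + 2 * inner v w + nsq w.
Proof.
by rewrite -!inner_nsq !(innerDl, innerC _ (_ + _)) (innerC w v); ring.
Qed.

Lemma nsqZ c v : nsq (c *: v) = c ^+ 2 * nsq v.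
Proof. by rewrite -!inner_nsq innerZl innerC innerZl; ring. Qed.

Lemma nsqN v : nsq (- v) = nsq v.
Proof. by rewrite -scaleN1r nsqZ sqrrN expr1n mul1r. Qed.

Lemma nsqB v w : nsq (v - w) = nsq v - 2 * inner v w + nsq w.
Proof. by rewrite nsqD nsqN innerC innerNl innerC; ring. Qed.

Lemma le_coord_nsq v i : v i 0 ^+ 2 <= nsq v.
Proof.
by rewrite /nsq (bigD1 i)//= lerDl sumr_ge0// => j _; exact: sqr_ge0.
Qed.

Lemma nsq_eq0 v : nsq v <= 0 -> v = 0.
Proof.
move=> v0; apply/colP => i; rewrite mxE; apply/eqP.
by rewrite -sqrf_eq0 eq_le sqr_ge0 andbT (le_trans (le_coord_nsq v i)).
Qed.

Lemma nsqD_le v w : nsq (v + w) <= 2 * nsq v + 2 * nsq w.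
Proof. by have := nsq_ge0 (v - w); rewrite nsqB nsqD; lra. Qed.

Lemma nsq_sum_le (m n : nat) (v : nat -> 'cV[R]_d) :
  nsq (\sum_(m <= j < n) v j) <= (n - m)%:R * \sum_(m <= j < n) nsq (v j).
Proof.
have [mn|nm] := leqP m n; last by rewrite !big_geq ?(ltnW nm)// mulr0 nsq0.
have [l ->] : exists l, n = (m + l)%N by exists (n - m)%N; rewrite subnKC.
rewrite addKn; elim: l => [|l IH]; first by rewrite addn0 !big_geq// mul0r nsq0.
rewrite addnS !big_nat_recr ?leq_addr//=.
move: IH; set s := \sum_(_ <= _ < _) _; set t := \sum_(_ <= _ < _) _ => IH.
case: l => [|l] in s t IH *.
  by rewrite mul0r in IH; rewrite (nsq_eq0 IH) add0r mul1r lerDr /t big_geq// addn0.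
have l0 : (0 : R) < l.+1%:R by rewrite ltr0n.
rewrite -(ler_pM2l l0) nsqD -[l.+2%:R]natr1.
(* Young's inequality weighted by the number l + 1 of terms already in [s]; the weight must be
   positive, hence the separate case of an empty sum. *)
have := nsq_ge0 (s - l.+1%:R *: v (m + l.+1)%N).
rewrite nsqB (innerC s) innerZl nsqZ (innerC _ s).
by move: (nsq s) (inner _ _) (nsq (v _)) IH l0 => a b c; nra.
Qed.
End Nsq.

Lemma smooth_nsq (R : realType) (d : nat) (L : R) (g : 'cV[R]_d -> R) v w :
  0 < L -> smooth L g -> nsq (grad g v - grad g w) <= L ^+ 2 * nsq (v - w).
Proof.
move=> L0 /(_ v w) gL; rewrite -!sqr_enorm -exprMn lerXn2r// nnegrE ?sqrtr_ge0//.
by rewrite mulr_ge0 ?sqrtr_ge0// ltW.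
Qed.

(** Substitutes a random parameter with countably many values, such as a rounded point, an index, a
    filter count or a mask. *)
Lemma measurable_fun_countable_param (d1 d2 : measure_display)
    (T : measurableType d1) (U : measurableType d2) (I : countType)
    (h : T -> I) (phi : I -> T -> U) :
  (forall i, measurable (h @^-1` [set i])) ->
  (forall i, measurable_fun setT (phi i)) ->
  measurable_fun setT (fun t => phi (h t) t).
Proof.
move=> mh mphi _ B mB; rewrite setTI.
rewrite (_ : _ @^-1` B = \bigcup_i (h @^-1` [set i] `&` phi i @^-1` B)).
  apply: countable_bigcupT_measurable => // i; apply: measurableI => //.
  by rewrite -[X in measurable X]setTI; exact: mphi.
apply/seteqP; split => [t Bt|t [i _ [/= <-]]]//.
by exists (h t).
Qed.

(* Rounding the parameter to a countable grid reduces joint measurability to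
   measurability at each fixed parameter. *)
Definition grid (R : realType) (d n : nat) (z : 'cV[int]_d) : 'cV[R]_d :=
  \col_i ((z i 0)%:~R / n.+1%:R).

Definition round (R : realType) (d n : nat) (v : 'cV[R]_d) : 'cV[int]_d :=
  \col_i Num.floor (n.+1%:R * v i 0).

Section Rounding.
Context (R : realType) (d : nat).

Lemma nsq_grid_round n (v : 'cV[R]_d) :
  nsq (grid R n (round n v) - v) <= d%:R * harmonic n ^+ 2.
Proof.
rewrite /nsq -[in leRHS](card_ord d) mulr_natl -sumr_const.
apply: ler_sum => i _; rewrite !mxE.
have n0 : (0 : R) < n.+1%:R by rewrite ltr0n.
rewrite -sqrrN opprB lerXn2r ?nnegrE//= ?invr_ge0 ?ler0n//.
  by rewrite subr_ge0 ler_pdivrMr// mulrC floor_le.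
rewrite -(ler_pM2r n0) mulrBl divfK ?gt_eqF// mulVf ?gt_eqF//.
by rewrite lerBlDl mulrC ltW// -intrD1 floorD1_gt.
Qed.

Lemma measurable_round (d1 : measure_display) (T : measurableType d1)
    (v : T -> 'cV[R]_d) n (z : 'cV[int]_d) :
  (forall i, measurable_fun setT (fun t => v t i 0)) ->
  measurable ((fun t => round n (v t)) @^-1` [set z]).
Proof.
move=> mv.
rewrite (_ : _ @^-1` _ = \bigcap_(i in [set: 'I_d])
    ((fun t => n.+1%:R * v t i 0) @^-1` `[(z i 0)%:~R, (z i 0)%:~R + 1[%classic)).
  apply: fin_bigcap_measurable => // i _; rewrite -[X in measurable X]setTI.
  by apply: measurable_funM.
apply/seteqP; split => [t /= <- i _ /=|t tz].
  by rewrite mxE in_itv/= floor_le/= -intrD1 floorD1_gt.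
apply/colP => i; have := tz i I; rewrite /= in_itv/= mxE => /andP[h1 h2].
by apply: floor_def; rewrite h1/= intrD.
Qed.

Lemma measurable_fun_lipschitz_param (d1 d2 : measure_display)
    (T : measurableType d1) (X : measurableType d2) (K : R)
    (g : 'cV[R]_d -> X -> R) (v : T -> 'cV[R]_d) :
  0 <= K ->
  (forall w, measurable_fun setT (g w)) ->
  (forall x w w', (g w x - g w' x) ^+ 2 <= K * nsq (w - w')) ->
  (forall i, measurable_fun setT (fun t => v t i 0)) ->
  measurable_fun setT (fun z : T * X => g (v z.1) z.2).
Proof.
move=> K0 mg gK mv.
apply: (measurable_fun_cvg
  (h := fun n (z : T * X) => g (grid R n (round n (v z.1))) z.2)).
  move=> n; apply: (measurable_fun_countable_param
    (h := fun z : T * X => round n (v z.1))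
    (phi := fun y (z : T * X) => g (grid R n y) z.2)).
    move=> z; apply: (@measurable_round _ _ (fun z => v z.1)) => i.
    by apply: (measurableT_comp (mv i)); exact: measurable_fst.
  move=> z; apply: (measurableT_comp (mg _)); exact: measurable_snd.
(* Rounding moves each of the d coordinates by at most 1 / (n + 1), so g changes by at most sqrt (K
   d) / (n + 1). *)
move=> [t x] _ /=; set r := Num.sqrt (K * d%:R).
have bnd n : `|g (v t) x - g (grid R n (round n (v t))) x| <= r * harmonic n.
  rewrite -(@ler_pXn2r _ 2)// ?nnegrE ?mulr_ge0 ?sqrtr_ge0 ?harmonic_ge0//.
  rewrite real_normK ?num_real// -sqrrN opprB (le_trans (gK _ _ _))//.
  rewrite exprMn sqr_sqrtr ?mulr_ge0 ?ler0n// -mulrA ler_wpM2l//.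
  exact: nsq_grid_round.
have : (fun n => r * harmonic n) @ \oo --> (0 : R).
  by rewrite -[X in _ --> X](mulr0 r); apply: cvgMr; exact: cvg_harmonic.
move=> /cvgrPdist_le h0; apply/cvgrPdist_le => e /h0.
apply: filterS => n; rewrite sub0r normrN => /(le_trans (ler_norm _)).
exact: le_trans.
Qed.
End Rounding.

(** * Measurability of the gradient and of its support *)

Section GradMeasurable.
Context (R : realType) (d : nat) (dX : measure_display) (X : measurableType dX).
Variable f : 'cV[R]_d -> X -> R.
Hypothesis f_diff : forall x v, differentiable (f ^~ x) v.
Hypothesis f_meas : forall v, measurable_fun setT (f v).

Lemma measurable_grad v i : measurable_fun setT (fun x => grad (f ^~ x) v i 0).
Proof.
pose e : 'cV[R]_d := delta_mx i 0.
(* The partial derivative is the limit of difference quotients along the steps 1 / (n + 1). *)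
apply: (measurable_fun_cvg (h := fun n x =>
  (harmonic n)^-1 * (f (harmonic n *: e + v) x - f v x))).
  by move=> n; apply: measurable_funM => //; exact: measurable_funB.
move=> x _; rewrite mxE.
have dfx : derivable (f ^~ x) v e by exact: diff_derivable.
have h0 : harmonic @ \oo --> (0 : R)^'.
  move=> A nA.
  have /= : \forall n \near \oo, harmonic n != 0 :> R -> A (harmonic n).
    exact: (@cvg_harmonic R _ nA).
  by apply: filterS => n; apply; rewrite invr_neq0// pnatr_eq0.
exact: cvg_comp h0 dfx.
Qed.

Variable L : R.
Hypothesis L_gt0 : 0 < L.
Hypothesis f_smooth : forall x, smooth L (f ^~ x).

Lemma grad_lipschitz x w w' i :
  (grad (f ^~ x) w i 0 - grad (f ^~ x) w' i 0) ^+ 2 <= L ^+ 2 * nsq (w - w').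
Proof.
apply: le_trans (smooth_nsq _ _ L_gt0 (f_smooth x)).
by apply: le_trans (le_coord_nsq _ i); rewrite !mxE.
Qed.

Lemma measurable_grad_param (d1 : measure_display) (T : measurableType d1)
    (v : T -> 'cV[R]_d) i :
  (forall j, measurable_fun setT (fun t => v t j 0)) ->
  measurable_fun setT (fun z : T * X => grad (f ^~ z.2) (v z.1) i 0).
Proof.
move=> mv; apply: (@measurable_fun_lipschitz_param _ _ _ _ _ _ (L ^+ 2)
  (fun w x => grad (f ^~ x) w i 0)) => //.
- exact: sqr_ge0.
- by move=> w; exact: measurable_grad.
- by move=> x w w'; exact: grad_lipschitz.
Qed.

(** Turns the quantifier over all w into a countable one, which makes [Dset] measurable: a
    coordinate of the gradient that vanishes on all grids vanishes everywhere by continuity. *)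
Lemma Dset_grid x i : i \in Dset f x <->
  exists (n : nat) (z : 'cV[int]_d), grad (f ^~ x) (grid R n z) i 0 != 0.
Proof.
rewrite inE; split => [/asboolP[w wi]|[n [z nz]]]; last first.
  by apply/asboolP; exists (grid R n z).
apply: contrapT => nz.
have g0 n : grad (f ^~ x) (grid R n (round n w)) i 0 = 0.
  by apply/eqP/negPn/negP => h; apply: nz; exists n, (round n w).
have h n : (grad (f ^~ x) w i 0) ^+ 2 <= L ^+ 2 * (d%:R * harmonic n ^+ 2).
  rewrite -[X in X ^+ 2]subr0 -(g0 n).
  rewrite -sqrrN opprB (le_trans (grad_lipschitz _ _ _ _))//.
  by rewrite ler_wpM2l ?sqr_ge0//; exact: nsq_grid_round.
move: wi; rewrite -sqrf_eq0 => /negP; apply.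
rewrite eq_le sqr_ge0 andbT.
have h0 : (fun n => L ^+ 2 * (d%:R * harmonic n ^+ 2)) @ \oo --> (0 : R).
  rewrite (_ : 0 = L ^+ 2 * (d%:R * (0 * 0))); last by ring.
  by apply: cvgMr; apply: cvgMr; apply: cvgM; exact: cvg_harmonic.
by apply: (cvgr_to_ge h0); exact: nearW.
Qed.

Lemma measurable_Dset i : measurable [set x | i \in Dset f x].
Proof.
rewrite (_ : [set _ | _] = \bigcup_n \bigcup_z
  [set x | grad (f ^~ x) (grid R n z) i 0 != 0]).
  apply: bigcupT_measurable => n; apply: countable_bigcupT_measurable => // z.
  rewrite (_ : [set _ | _] =
    (fun x => grad (f ^~ x) (grid R n z) i 0) @^-1` (~` [set 0])).
    rewrite -[X in measurable X]setTI.
    by apply: measurable_grad => //; exact: measurableC.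
  by apply/seteqP; split => x /= /eqP.
apply/seteqP; split => x /=.
  by move/Dset_grid => [n [z nz]]; exists n => //; exists z.
by move=> [n _ [z _ nz]]; apply/Dset_grid; exists n, z.
Qed.

Lemma measurable_nfilters D : measurable_fun setT (nfilters f D).
Proof.
apply: (measurable_fun_countable_param (h := Dset f) (phi := fun A _ =>
  if (D <= #|A|)%N then D else #|A|)) => // A.
rewrite (_ : _ @^-1` _ = \bigcap_(i in [set: 'I_d])
  (if i \in A then [set x | i \in Dset f x] else ~` [set x | i \in Dset f x])).
  apply: fin_bigcap_measurable => // i _.
  by case: ifP => _; [|apply: measurableC]; exact: measurable_Dset.
apply/seteqP; split => x /=; first by move=> <- i _; case: ifPn => //= /negP.
move=> xA; apply/finset.setP => i; move: (xA i I).
by case: ifP => //= _ /negP/negbTE.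
Qed.

End GradMeasurable.

(** * Averaging over the random filter *)

Section RestrictedLaw.
Context (dO dX : measure_display) (Omega : measurableType dO)
  (X : measurableType dX) (R : realType) (P : probability Omega R).

Lemma ge0_integral_mrestr (E : set Omega) (mE : measurable E)
    (g : Omega -> \bar R) :
  measurable_fun setT g -> (forall om, 0 <= g om)%E ->
  (\int[P]_(om in E) g om = \int[mrestr P mE]_om g om)%E.
Proof.
move=> mg g0; rewrite -[X in (\int[mrestr _ _]_(_ in X) _)%E](setvU E).
rewrite ge0_integral_setU//=; first last.
- by rewrite disj_set2E setICl.
- by rewrite setvU.
- exact: measurableC.
rewrite [X in _ = (X + _)%E]null_set_integral ?add0e//; first last.
- by change (P (~` E `&` E) = 0%E); rewrite setICl measure0.
- exact: measurable_funS mg.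
- exact: measurableC.
by apply: eq_measure_integral => A mA AE; change (P A = P (A `&` E)); rewrite setIidl.
Qed.

(** The hypothesis says that the restrictions of [P] to [E] and [E'] have proportional images under
    [xi]. It is applied with [E'] the event that there are n filters, [E] its part where the index
    is j, and c = 1 / n. *)
Lemma ge0_integral_restricted_law (xi : {RV P >-> X}) (E E' : set Omega)
    (c : {nonneg R}) (g : X -> \bar R) :
  measurable E -> measurable E' ->
  (forall A, measurable A ->
    P (xi @^-1` A `&` E) = (c%:num%:E * P (xi @^-1` A `&` E'))%E) ->
  measurable_fun setT g -> (forall x, 0 <= g x)%E ->
  (\int[P]_(om in E) g (xi om) = c%:num%:E * \int[P]_(om in E') g (xi om))%E.
Proof.
move=> mE mE' EE' mg g0.
have mgx : measurable_fun setT (g \o xi) by exact: measurableT_comp.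
rewrite !ge0_integral_mrestr//.
have mxi : measurable_fun setT xi by exact: measurable_funP.
pose nu (B : set Omega) (mB : measurable B) : {measure set X -> \bar R} :=
  measure_function_pushforward__canonical__measure_function_Measure
    (mrestr P mB) mxi.
have nuE B (mB : measurable B) :
    (\int[mrestr P mB]_om g (xi om) = \int[nu B mB]_x g x)%E.
  by rewrite ge0_integral_pushforward.
rewrite !nuE -ge0_integral_mscale//.
by apply: eq_measure_integral => A mA _; exact: EE'.
Qed.

End RestrictedLaw.

(** * Averaging over a uniform index given xi *)

Section UniformIndex.
Context (dO dX : measure_display) (Omega : measurableType dO)
  (X : measurableType dX) (R : realType) (P : probability Omega R).
Variables (xi : {RV P >-> X}) (u : {RV P >-> nat}) (m : X -> nat).
Hypothesis m_meas : measurable_fun setT m.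
Hypothesis unif : forall A n j, measurable A -> (j < n)%N ->
  P [set om | [/\ A (xi om), m (xi om) = n & u om = j]] =
    ((n%:R^-1)%:E * P [set om | A (xi om) /\ m (xi om) = n])%E.

Let count_is n := [set om | m (xi om) = n].
Let index_is j := [set om | u om = j].

Let measurable_count n : measurable (count_is n).
Proof.
rewrite (_ : count_is n = (m \o xi) @^-1` [set n])//.
by rewrite -[X in measurable X]setTI; exact: (measurableT_comp m_meas).
Qed.

Let measurable_index j : measurable (index_is j).
Proof.
rewrite (_ : index_is j = u @^-1` [set j])//.
by rewrite -[X in measurable X]setTI; exact: measurable_funP.
Qed.

Let indices n := \big[setU/set0]_(j < n) (count_is n `&` index_is j).

Let trivIset_indices n (D : set 'I_n) :
  trivIset D (fun j : 'I_n => count_is n `&` index_is j).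
Proof.
by move=> i j _ _ [om [[_ ui] [_ uj]]]; apply: val_inj; rewrite /= -ui -uj.
Qed.

Let measurable_indices n : measurable (indices n).
Proof. by apply: bigsetU_measurable => j _; exact: measurableI. Qed.

Let indices_sub n : indices n `<=` count_is n.
Proof.
by rewrite /indices -(bigcup_mkord _ (fun j => count_is n `&` index_is j)) => om [j _ []].
Qed.

(** The n disjoint cells have mass P(count = n) / n each and so exhaust the event: uniformity itself
    forces the index to be admissible almost surely. *)
Let negligible_index n : (0 < n)%N -> P (count_is n `\` indices n) = 0%E.
Proof.
move=> n0; rewrite measureD//; last by rewrite ltey_eq fin_num_measure.
rewrite setIidr//.
rewrite [X in (_ - X)%E](_ : _ = P (count_is n)).
  by rewrite subee// fin_num_measure.
rewrite /indices measure_bigsetU_ord//; last by move=> j; exact: measurableI.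
have fp : P (count_is n) \is a fin_num by rewrite fin_num_measure.
have cell (j : 'I_n) :
    P (count_is n `&` index_is j) = (n%:R^-1 * fine (P (count_is n)))%:E.
  rewrite EFinM fineK// [X in P X](_ : _ =
    [set om | [/\ setT (xi om), m (xi om) = n & u om = j]]); last first.
    by apply/seteqP; split => om /= [].
  rewrite unif//; congr (_ * P _)%E.
  by apply/seteqP; split => om // [].
rewrite (eq_bigr _ (fun j _ => cell j)).
rewrite sumEFin sumr_const card_ord -[(_ * _) *+ n]mulr_natl mulrA divff ?mul1r ?fineK//.
by rewrite pnatr_eq0 -lt0n.
Qed.


(** Here [H] is the conditional mean of h given xi. Where [m x = 0] nothing is known about the
    index, so h must not depend on it there. *)
Lemma ge0_integral_uniform_index (h : X -> nat -> \bar R) (H : X -> \bar R) :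
  (forall j, measurable_fun setT (h ^~ j)) -> measurable_fun setT H ->
  (forall x j, 0 <= h x j)%E -> (forall x, 0 <= H x)%E ->
  (forall x j, m x = 0%N -> h x j = H x) ->
  (forall x, (0 < m x)%N -> H x = ((m x)%:R^-1%:E * \sum_(j < m x) h x j)%E) ->
  (\int[P]_om h (xi om) (u om) = \int[P]_om H (xi om))%E.
Proof.
move=> mh mH h0 H0 hH0 hH.
have mhu : measurable_fun setT (fun om => h (xi om) (u om)).
  apply: (measurable_fun_countable_param (h := u)
    (phi := fun j om => h (xi om) j)) => j; first exact: measurable_index.
  exact: (measurableT_comp (mh j)).
have mHx : measurable_fun setT (fun om => H (xi om)) by exact: measurableT_comp.
have -> : [set: Omega] = \bigcup_n count_is n.
  by apply/seteqP; split => // om _; exists (m (xi om)).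
have tm : trivIset setT count_is by move=> i j _ _ [om [<- <-]].
rewrite !ge0_integral_bigcup//; try exact: measurable_funTS.
apply: eq_eseriesr => -[_|n _].
  by apply: eq_integral => om /[!inE] m0; exact: hH0.
(* Discards the null event that the index is out of range. *)
rewrite (ge0_negligible_integral _ _ _ _ (negligible_index (ltn0Sn n)))//;
  [|exact: measurableD|exact: measurable_funTS].
rewrite setDD setIidr//.
rewrite /indices ge0_integral_bigsetU//=; first last.
- exact: measurable_funTS.
- exact: index_enum_uniq.
- by move=> j; exact: measurableI.
have c0 : (0 : R) <= n.+1%:R^-1 by rewrite invr_ge0 ler0n.
pose c := NngNum c0.
have hj (j : 'I_n.+1) : (\int[P]_(om in count_is n.+1 `&` index_is j) h (xi om) (u om) =
    c%:num%:E * \int[P]_(om in count_is n.+1) h (xi om) j)%E.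
  transitivity (\int[P]_(om in count_is n.+1 `&` index_is j) h (xi om) j)%E.
    by apply: eq_integral => om /[!inE] -[_ ->].
  apply: (ge0_integral_restricted_law (g := h ^~ j)) => //.
    exact: measurableI.
  move=> A mA; rewrite [X in P X](_ : _ =
      [set om | [/\ A (xi om), m (xi om) = n.+1 & u om = j]]).
    by rewrite unif.
  by apply/seteqP; split => om /=; [move=> [? []]|move=> [? ? ?]].
rewrite (eq_bigr _ (fun j _ => hj j)) -ge0_sume_distrr; last first.
  by move=> j _; exact: integral_ge0.
rewrite -ge0_integral_sum//; last first.
  by move=> j; apply: measurable_funTS;
  exact: (measurableT_comp (mh j)).
have mS : measurable_fun (count_is n.+1) (fun om => \sum_(j < n.+1) h (xi om) j)%E.
  apply: emeasurable_sum => j; apply: measurable_funTS.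
  exact: (measurableT_comp (mh j)).
rewrite -(ge0_integralZl P (measurable_count _) mS)//; last first.
  by move=> om _; exact: sume_ge0.
by apply: eq_integral => om /[!inE] mn; rewrite hH mn.
Qed.

End UniformIndex.

(** Bundling integrability with a real value lets expectations be handled by algebra in [R] instead
    of the extended reals. *)
Definition has_mean (dO : measure_display) (Omega : measurableType dO)
    (R : realType) (P : probability Omega R) (Y : Omega -> R) (c : R) : Prop :=
  integrableRV P Y /\ (\int[P]_om (Y om)%:E)%E = c%:E.

Section HasMean.
Context (dO : measure_display) (Omega : measurableType dO) (R : realType)
  (P : probability Omega R).
Implicit Types (Y Z : Omega -> R) (a b c : R).

Lemma has_mean_cst c : has_mean P (cst c) c.
Proof.
split; first exact: finite_measure_integrable_cst.
by have := expectation_cst P c; rewrite unlock.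
Qed.

Lemma has_meanD Y Z a b :
  has_mean P Y a -> has_mean P Z b -> has_mean P (fun om => Y om + Z om) (a + b).
Proof.
move=> [iY EY] [iZ EZ]; split.
  rewrite /integrableRV (_ : _ \o _ = (EFin \o Y) \+ (EFin \o Z))%E//.
  exact: integrableD.
under eq_integral do rewrite EFinD.
by rewrite integralD// EY EZ.
Qed.

Lemma has_meanZ c Y a : has_mean P Y a -> has_mean P (fun om => c * Y om) (c * a).
Proof.
move=> [iY EY]; split.
  rewrite /integrableRV (_ : _ \o _ = (fun om => c%:E * (EFin \o Y) om)%E)//.
  exact: integrableZl.
under eq_integral do rewrite EFinM.
by rewrite integralZl// EY.
Qed.

Lemma has_mean_sum (I : eqType) (s : seq I) (Y : I -> Omega -> R) (a : I -> R) :
  (forall i, i \in s -> has_mean P (Y i) (a i)) ->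
  has_mean P (fun om => \sum_(i <- s) Y i om) (\sum_(i <- s) a i).
Proof.
elim: s => [|i s IH] h.
  rewrite big_nil (_ : (fun _ => _) = cst 0); first exact: has_mean_cst.
  by apply/funext => om; rewrite big_nil.
rewrite big_cons (_ : (fun _ => _) = fun om => Y i om + \sum_(j <- s) Y j om).
  apply: has_meanD; first by apply: h; rewrite mem_head.
  by apply: IH => j js; apply: h; rewrite in_cons js orbT.
by apply/funext => om; rewrite big_cons.
Qed.

Lemma has_mean_le Y Z a b :
  has_mean P Y a -> has_mean P Z b -> (forall om, Y om <= Z om) -> a <= b.
Proof.
move=> [iY EY] [iZ EZ] YZ; rewrite -lee_fin -EY -EZ.
by apply: le_integral => // om _; rewrite lee_fin.
Qed.

Lemma ge0_has_mean Y c : measurable_fun setT Y -> (forall om, 0 <= Y om) ->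
  (\int[P]_om (Y om)%:E)%E = c%:E -> has_mean P Y c.
Proof.
move=> mY Y0 EY; split => //; apply/integrableP; split.
  exact/measurable_EFinP.
by under eq_integral do rewrite gee0_abs ?lee_fin//=; rewrite EY ltry.
Qed.

Lemma has_mean_bounded Y c : measurable_fun setT Y -> (forall om, 0 <= Y om) ->
  (\int[P]_om (Y om)%:E <= c%:E)%E -> exists2 b, b <= c & has_mean P Y b.
Proof.
move=> mY Y0 Yc.
have I0 : (0 <= \int[P]_om (Y om)%:E)%E.
  by apply: integral_ge0 => om _; rewrite lee_fin.
have If : (\int[P]_om (Y om)%:E)%E \is a fin_num.
  by rewrite ge0_fin_numE//; exact: le_lt_trans Yc (ltry _).
exists (fine (\int[P]_om (Y om)%:E)%E); first by rewrite -lee_fin fineK.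
by apply: ge0_has_mean => //; rewrite fineK.
Qed.

Lemma has_mean_dominated Y Z c : measurable_fun setT Y ->
  (forall om, 0 <= Y om <= Z om) -> has_mean P Z c -> exists b, has_mean P Y b.
Proof.
move=> mY YZ [iZ EZ].
have [||b _ hb] := @has_mean_bounded Y c mY; last by exists b.
  by move=> om; have /andP[] := YZ om.
have /integrableP[mZ _] := iZ.
rewrite -EZ; apply: ge0_le_integral => //.
- by move=> om _; rewrite lee_fin; have /andP[] := YZ om.
- exact/measurable_EFinP.
- by move=> om _; rewrite lee_fin; have /andP[] := YZ om.
Qed.

End HasMean.

(** The body of [filtered_step] with its dependence on the past (stepsize [e], read vector [v])
    separated from the fresh pair [z], so that the former can be frozen. *)
Definition filtered_grad (R : realType) (d : nat) (X : Type)
    (f : 'cV[R]_d -> X -> R) (D : nat) (S : X -> nat -> {set 'I_d})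
    (e : R) (v : 'cV[R]_d) (z : X * nat) : 'cV[R]_d :=
  (e * (nfilters f D z.1)%:R) *:
    (mask_mx R (S z.1 z.2) *m grad (f ^~ z.1) v).

Lemma mask_mxE (R : realType) (d : nat) (A : {set 'I_d}) (v : 'cV[R]_d) i :
  (mask_mx R A *m v) i 0 = (i \in A)%:R * v i 0.
Proof. by rewrite mul_diag_mx !mxE. Qed.

Lemma nsq_mask_sub_le (R : realType) (d : nat) (A : {set 'I_d}) (v : 'cV[R]_d) :
  nsq (mask_mx R A *m v - v) <= nsq v.
Proof.
apply: ler_sum => i _; rewrite mxE mask_mxE mxE.
case: (i \in A); first by rewrite mul1r subrr expr0n sqr_ge0.
by rewrite mul0r sub0r sqrrN.
Qed.

Section FilterAverage.
Context (R : realType) (d : nat) (X : Type) (f : 'cV[R]_d -> X -> R).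
Variables (D : nat) (S : X -> nat -> {set 'I_d}).
Hypothesis D_gt0 : (0 < D)%N.
Hypothesis S_filters : filters f D S.

Let sum_filters x i :
  \sum_(j < nfilters f D x) (i \in S x j)%:R = (i \in Dset f x)%:R :> R.
Proof.
have [/matrixP/(_ i i) + _ _] := S_filters x.
rewrite summxE mxE mxE eqxx mulr1n => <-.
by apply: eq_bigr => j _; rewrite !mxE eqxx mulr1n.
Qed.

Let grad_outside x v i : i \notin Dset f x -> grad (f ^~ x) v i 0 = 0.
Proof.
rewrite inE => /asboolPn h; apply/eqP/negPn/negP => gi.
by apply: h; exists v.
Qed.

Lemma nfilters_le x : (nfilters f D x <= D)%N.
Proof. by rewrite /nfilters; case: ifPn => //; rewrite -ltnNge => /ltnW. Qed.

Lemma grad_nfilters0 x v : nfilters f D x = 0%N -> grad (f ^~ x) v = 0.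
Proof.
move=> n0; apply/colP => i; rewrite [RHS]mxE; apply: grad_outside.
move: n0; rewrite /nfilters; case: ifP => _.
  by move/eqP; rewrite -leqn0 leqNgt D_gt0.

by move=> /eqP; rewrite cards_eq0 => /eqP ->; rewrite inE.
Qed.

(** Filter entries are 0 or 1, hence equal to their squares, so the linear and the quadratic sums
    both collapse to D_xi, which supports the gradient. Averaging cancels d_xi in the cross term but
    leaves one factor d_xi in the square. *)
Lemma sum_nsq_filtered_grad (p v : 'cV[R]_d) (e : R) x :
  \sum_(j < nfilters f D x) nsq (p - filtered_grad f D S e v (x, nat_of_ord j)) =
  (nfilters f D x)%:R *
    (nsq p - 2 * e * inner p (grad (f ^~ x) v) +
     e ^+ 2 * (nfilters f D x)%:R * nsq (grad (f ^~ x) v)).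
Proof.
set m := nfilters f D x; set g := grad _ v.
have sumy : \sum_(j < m) inner p (mask_mx R (S x j) *m g) = inner p g.
  rewrite exchange_big/=; apply: eq_bigr => i _.
  under eq_bigr do rewrite mask_mxE mulrA.
  rewrite -mulr_suml -mulr_sumr sum_filters -mulrA.

  by case: (boolP (i \in _)) => [_|/grad_outside ->]; rewrite ?mul1r// !mulr0.
have sumy2 : \sum_(j < m) nsq (mask_mx R (S x j) *m g) = nsq g.
  rewrite exchange_big/=; apply: eq_bigr => i _.
  under eq_bigr => j _.
    rewrite mask_mxE exprMn (_ : _%:R ^+ 2 = (i \in S x j)%:R); last first.
      by case: (i \in _); rewrite ?expr1n// expr0n.
    over.
  rewrite -mulr_suml sum_filters.
  by case: (boolP (i \in _)) => [_|/grad_outside ->]; rewrite ?mul1r// expr0n mulr0.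
under eq_bigr do rewrite /filtered_grad/= nsqB nsqZ innerC innerZl innerC !mulrA.
rewrite big_split sumrB/= -!mulr_sumr sumy sumy2 sumr_const card_ord -mulr_natl.
by rewrite /m; ring.
Qed.

End FilterAverage.

(** * Stochastic gradients *)

Section Oracle.
Context (R : realType) (d : nat) (dO dX : measure_display)
  (Omega : measurableType dO) (X : measurableType dX) (P : probability Omega R).
Variables (xi : {RV P >-> X}) (f : 'cV[R]_d -> X -> R) (F : 'cV[R]_d -> R).
Hypothesis f_diff : forall x v, differentiable (f ^~ x) v.
Hypothesis f_meas : forall v, measurable_fun setT (f v).
Hypothesis grad_int : forall v i,
  integrableRV P (fun om => grad (f ^~ (xi om)) v i 0).
Hypothesis grad_unbiased : forall v i,
  'E_P[fun om => (grad (f ^~ (xi om)) v i 0)%R]%E = (grad F v i 0)%:E.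
Variables (mu L : R).
Hypothesis L_gt0 : 0 < L.
Hypothesis F_sc : strongly_convex mu F.
Hypothesis f_smooth : forall x, smooth L (f ^~ x).
Variable wstar : 'cV[R]_d.
Hypothesis wstar_min : unique_minimizer F wstar.

Lemma has_mean_inner_grad q v :
  has_mean P (fun om => inner q (grad (f ^~ (xi om)) v)) (inner q (grad F v)).
Proof.
have h i : has_mean P (fun om => grad (f ^~ (xi om)) v i 0) (grad F v i 0).
  by split => //; rewrite -grad_unbiased unlock.
exact: (has_mean_sum (fun i _ => has_meanZ (q i 0) (h i))).
Qed.

(** With g the random difference of gradients, |a|^2 = E <a, g> is at most the mean of (|a|^2 +
    |g|^2) / 2, and half of |a|^2 is absorbed on the left. This takes the place of Jensen's
    inequality. *)
Lemma grad_mean_lipschitz v w :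
  nsq (grad F v - grad F w) <= L ^+ 2 * nsq (v - w).
Proof.
set a := grad F v - grad F w.
have h1 : has_mean P (fun om => inner a (grad (f ^~ (xi om)) v) +
    -1 * inner a (grad (f ^~ (xi om)) w)) (nsq a).
  have -> : nsq a = inner a (grad F v) + -1 * inner a (grad F w).
    by rewrite -inner_nsq {1}/a innerBl !(innerC _ a) mulN1r.
  by apply: has_meanD; [|apply: has_meanZ]; exact: has_mean_inner_grad.
have h2 := has_mean_cst P (2^-1 * nsq a + 2^-1 * (L ^+ 2 * nsq (v - w))).
suff : nsq a <= 2^-1 * nsq a + 2^-1 * (L ^+ 2 * nsq (v - w)) by lra.
apply: (has_mean_le h1 h2) => om /=.
have := smooth_nsq v w L_gt0 (f_smooth (xi om)).
set g := grad _ v - _ => gL.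
have -> : inner a (grad (f ^~ (xi om)) v) + -1 * inner a (grad (f ^~ (xi om)) w)
    = inner a g by rewrite !(innerC a) innerBl mulN1r.
by have := nsq_ge0 (a - g); rewrite nsqB; lra.
Qed.

Hypothesis mu_gt0 : 0 < mu.

(** Strong convexity based at v and tested at [wstar], with F v - F w* >= 0 dropped. It does not
    presuppose that the gradient vanishes at [wstar], and so can serve to prove it. *)
Lemma inner_grad_ge v : mu / 2 * nsq (v - wstar) <= inner (grad F v) (v - wstar).
Proof.
have Fle : F wstar <= F v.
  by have [->|/wstar_min/ltW] := eqVneq v wstar.
have := F_sc wstar v; rewrite sqr_enorm -opprB nsqN innerC innerNl innerC.
by move: (inner _ _) (mu / 2 * _) => a b; lra.
Qed.

(* With g = grad F w* and y = w* - g / (2 L), convexity gives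
   <grad F y, g> <= 0, while |grad F y - g|^2 <= |g|^2 / 4. *)
Lemma grad_wstar : grad F wstar = 0.
Proof.
set g := grad F wstar; apply: nsq_eq0.
pose s := (2 * L)^-1.
have s0 : 0 < s by rewrite invr_gt0 mulr_gt0.
have sL : L ^+ 2 * s ^+ 2 = 4^-1.
  by rewrite /s; field; rewrite gt_eqF.
pose y := wstar - s *: g; set k := grad F y.
have yE : y - wstar = - (s *: g) by rewrite /y addrAC subrr add0r.
have nyE : nsq (y - wstar) = s ^+ 2 * nsq g by rewrite yE nsqN nsqZ.
have g0 : 0 <= nsq g by exact: nsq_ge0.
have := inner_grad_ge y; have := grad_mean_lipschitz y wstar.
rewrite -/k -/g !nyE mulrA sL yE innerC innerNl innerZl innerC nsqB => h2 h1.
have gk : inner k g <= 0.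
  rewrite -(pmulr_rle0 _ s0) -oppr_ge0; apply: le_trans h1.
  by apply: mulr_ge0; [apply: divr_ge0 => //; exact: ltW|rewrite mulr_ge0// sqr_ge0].
by have := nsq_ge0 k; lra.
Qed.

Lemma nsq_grad_mean_le v : nsq (grad F v) <= L ^+ 2 * nsq (v - wstar).
Proof. by have := grad_mean_lipschitz v wstar; rewrite grad_wstar subr0. Qed.

(* [v] is the vector read with delay, [w] the current iterate. *)
Lemma delayed_descent v w :
  - (2 * inner (w - wstar) (grad F v)) <=
  - (mu / 2 * nsq (v - wstar)) + 2 * L ^+ 2 / mu * nsq (w - v).
Proof.
have h1 := inner_grad_ge v; have h2 := nsq_grad_mean_le v.
have mu0 : mu != 0 by rewrite gt_eqF.
rewrite (_ : w - wstar = (v - wstar) + (w - v)); last first.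
  by rewrite [RHS]addrC addrA subrK.
rewrite innerDl innerC (innerC (w - v)).
(* Young's weight: th |grad F v|^2 takes at most half of the mu |v - w*|^2 supplied by strong
   convexity, and 1 / th becomes the coefficient of the delay error. *)
pose th := mu / (2 * L ^+ 2).
have th0 : 0 < th by rewrite divr_gt0// mulr_gt0// exprn_gt0.
have L20 : 0 < L ^+ 2 by rewrite exprn_gt0.
have h3 := nsq_ge0 (th *: grad F v + (w - v)).
rewrite (nsqD (th *: _)) nsqZ innerZl in h3.
have h4 : th * nsq (grad F v) <= mu / 2 * nsq (v - wstar).
  apply: (le_trans (ler_wpM2l (ltW th0) h2)).
  by rewrite mulrA /th le_eqVlt; apply/orP; left; apply/eqP; field; rewrite gt_eqF.
have h5 : - (2 * inner (grad F v) (w - v)) <=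
    th * nsq (grad F v) + 2 * L ^+ 2 / mu * nsq (w - v).
  have -> : 2 * L ^+ 2 / mu = th^-1 by rewrite /th invf_div.
  rewrite -(ler_pM2l th0) mulrDr (mulrA th th^-1) divff ?gt_eqF// mul1r.
  by move: h3; nra.
by lra.
Qed.

Hypothesis N_fin :
  (2%:E * 'E_P[fun om => (enorm (grad (f ^~ (xi om)) wstar) ^+ 2)%R] < +oo)%E.

Lemma measurable_nsq_grad v :
  measurable_fun setT (fun x => nsq (grad (f ^~ x) v)).
Proof. by apply: measurable_sum => i; apply: measurable_funX; exact: measurable_grad. Qed.

(** This [N] is the mean without the factor 2, which is why later bounds carry [2 * N]. *)
Lemma has_mean_noise : exists2 N : R, 0 <= N &
  has_mean P (fun om => nsq (grad (f ^~ (xi om)) wstar)) N.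
Proof.
pose E := (\int[P]_om (nsq (grad (f ^~ (xi om)) wstar))%:E)%E.
have E0 : (0 <= E)%E by apply: integral_ge0 => om _; rewrite lee_fin nsq_ge0.
have Efin : E \is a fin_num.
  rewrite ge0_fin_numE// ltNge; apply/negP; rewrite leye_eq => /eqP Eoo.
  move: N_fin; rewrite unlock; under eq_integral do rewrite sqr_enorm.
  by rewrite -/E Eoo mulry gtr0_sg// mul1e ltxx.
exists (fine E); first exact: fine_ge0.
apply: ge0_has_mean; [|by move=> om; exact: nsq_ge0|by rewrite fineK].
exact: (measurableT_comp (measurable_nsq_grad _)).
Qed.

Variables (D : nat) (S : X -> nat -> {set 'I_d}).
Hypothesis D_gt0 : (0 < D)%N.
Hypothesis S_filters : filters f D S.
Hypothesis S_meas : forall n i, measurable [set x | i \in S x n].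

(** The joint measurability behind Tonelli's theorem, with [T] the space of pasts: filter count and
    index are countable parameters, the read vector is a Lipschitz one. *)
Lemma measurable_filtered_grad (e : R) (d1 : measure_display)
    (T : measurableType d1) (v : T -> 'cV[R]_d) i :
  (forall j, measurable_fun setT (fun t => v t j 0)) ->
  measurable_fun setT
    (fun z : T * (X * nat) => filtered_grad f D S e (v z.1) z.2 i 0).
Proof.
move=> mv.
have mz1 : measurable_fun setT (fun z : T * (X * nat) => z.2.1).
  exact: (measurableT_comp measurable_fst measurable_snd).
have mz2 : measurable_fun setT (fun z : T * (X * nat) => z.2.2).
  exact: (measurableT_comp measurable_snd measurable_snd).
rewrite (_ : (fun z => _) = fun z => e * (nfilters f D z.2.1)%:R *
    ((i \in S z.2.1 z.2.2)%:R * grad (f ^~ z.2.1) (v z.1) i 0)); last first.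
  by apply/funext => z; rewrite /filtered_grad mxE mask_mxE.
apply: measurable_funM.
  apply: measurable_funM => //.
  apply: (measurable_fun_countable_param 
    (h := fun z : T * (X * nat) => nfilters f D z.2.1)
    (phi := fun n _ => n%:R : R)) => // n.
  rewrite -[X in measurable X]setTI.
  exact: (measurableT_comp (measurable_nfilters f_diff f_meas L_gt0 f_smooth D) mz1).
apply: measurable_funM.
  apply: (measurable_fun_countable_param 
    (h := fun z : T * (X * nat) => z.2.2)
    (phi := fun n z => (i \in S z.2.1 n)%:R : R)) => n.
    by rewrite -[X in measurable X]setTI; exact: mz2.
  rewrite (_ : (fun z => _) = \1_[set x | i \in S x n] \o (fun z => z.2.1)).
    by apply: measurableT_comp => //; exact: measurable_indic.
  by apply/funext => z; rewrite /= indicE mem_setE.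
have mtx : measurable_fun setT (fun z : T * (X * nat) => (z.1, z.2.1)).
  by apply: measurable_fun_pair => //; exact: measurable_fst.
exact: (measurableT_comp
  (measurable_grad_param f_diff f_meas L_gt0 f_smooth i mv) mtx).
Qed.

(** The one-step bound with the past frozen, used twice: [p] = w_t - w* yields the next squared
    distance, [p] = 0 the squared increment. *)
Lemma ge0_integral_filtered_grad_le (xit : {RV P >-> X}) (ut : {RV P >-> nat})
    (N : R) (e : R) (p v : 'cV[R]_d) :
  (forall A, measurable A -> distribution P xit A = distribution P xi A) ->
  (forall A n j, measurable A -> (j < n)%N ->
    P [set om | [/\ A (xit om), nfilters f D (xit om) = n & ut om = j]] =
    ((n%:R^-1)%:E * P [set om | A (xit om) /\ nfilters f D (xit om) = n])%E) ->
  has_mean P (fun om => nsq (grad (f ^~ (xi om)) wstar)) N ->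
  (\int[P]_om (nsq (p - filtered_grad f D S e v (xit om, ut om)))%:E <=
   (nsq p - 2 * e * inner p (grad F v) +
    e ^+ 2 * D%:R * (2 * L ^+ 2 * nsq (v - wstar) + 2 * N))%:E)%E.
Proof.
move=> xit_law unif hN.
pose g x := grad (f ^~ x) v.
(* [H] is the mean over the index given xi. Its majorant [G] replaces d_xi by [D] and splits the
   gradient at [wstar] into a Lipschitz part and the noise. *)
pose H x := nsq p - 2 * e * inner p (g x) +
   e ^+ 2 * (nfilters f D x)%:R * nsq (g x).
pose G x := nsq p - 2 * e * inner p (g x) +
   e ^+ 2 * D%:R * (2 * L ^+ 2 * nsq (v - wstar) + 2 * nsq (grad (f ^~ x) wstar)).
have mnf := measurable_nfilters f_diff f_meas L_gt0 f_smooth D.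
have HG x : H x <= G x.
  rewrite /H /G lerD2l -[leLHS]mulrA -[leRHS]mulrA ler_wpM2l ?sqr_ge0//.
  rewrite ler_pM ?ler0n ?nsq_ge0 ?ler_nat ?nfilters_le//.
  rewrite -[g x](subrK (grad (f ^~ x) wstar)) (le_trans (nsqD_le _ _))//.
  by rewrite lerD2r -[leRHS]mulrA ler_wpM2l// smooth_nsq.
have H0 x : 0 <= H x.
  have [m0|m0] := posnP (nfilters f D x).
    rewrite /H m0 /g (grad_nfilters0 D_gt0 v m0) inner0r nsq0 !mulr0.
    by rewrite subr0 addr0 nsq_ge0.
  rewrite -(pmulr_rge0 _ (_ : 0 < (nfilters f D x)%:R)) ?ltr0n//.
  rewrite -(sum_nsq_filtered_grad S_filters); apply: sumr_ge0 => j _; exact: nsq_ge0.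
have mg i : measurable_fun setT (fun x => g x i 0) by exact: measurable_grad.
have mH : measurable_fun setT H.
  apply: measurable_funD.
    apply: measurable_funB => //; apply: measurable_funM => //.
    by apply: measurable_sum => i; exact: measurable_funM.
  apply: measurable_funM; last exact: measurable_nsq_grad.
  apply: measurable_funM => //.
  apply: (measurable_fun_countable_param (h := nfilters f D)
    (phi := fun n _ => n%:R : R)) => // n.
  by rewrite -[X in measurable X]setTI; exact: mnf.
rewrite (ge0_integral_uniform_index mnf unif (H := EFin \o H)
  (h := fun x j => (nsq (p - filtered_grad f D S e v (x, j)))%:E)) //=; last 5 first.
- move=> j; apply/measurable_EFinP; apply: measurable_sum => i.
  apply: measurable_funX.
  rewrite (_ : (fun x => _) = fun x => p i 0 -
      filtered_grad f D S e v (x, j) i 0); last by apply/funext => x; rewrite !mxE.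
  apply: measurable_funB => //.
  have mxj : measurable_fun setT (fun x : X => (x, (x, j))).
    by apply: measurable_fun_pair => //; exact: measurable_fun_pair.
  exact: (measurableT_comp
    (@measurable_filtered_grad e _ X (fun=> v) i (fun=> measurable_cst _)) mxj).
- exact/measurable_EFinP.
- by move=> x j; rewrite lee_fin nsq_ge0.
- move=> x j m0; rewrite /filtered_grad/= m0 mulr0 scale0r subr0.
  by rewrite /H m0 /g (grad_nfilters0 D_gt0 v m0) inner0r nsq0 !mulr0 subr0 addr0.
- move=> x m0; rewrite sumEFin -EFinM (sum_nsq_filtered_grad S_filters) mulKf//.
  by rewrite pnatr_eq0 -lt0n.
have hG : has_mean P (G \o xi) (nsq p - 2 * e * inner p (grad F v) +
    e ^+ 2 * D%:R * (2 * L ^+ 2 * nsq (v - wstar) + 2 * N)).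
  have := has_meanD
    (has_meanD (has_mean_cst P (nsq p)) (has_meanZ (- (2 * e)) (has_mean_inner_grad p v)))
    (has_meanZ (e ^+ 2 * D%:R) (has_meanD
      (has_mean_cst P (2 * L ^+ 2 * nsq (v - wstar))) (has_meanZ 2 hN))).
  by rewrite mulNr; congr has_mean; apply/funext => om; rewrite /G/= mulNr.
rewrite -(hG.2).
have -> : (\int[P]_om (H (xit om))%:E = \int[P]_om (H (xi om))%:E)%E.
  have tr (Y : {RV P >-> X}) :
      (\int[P]_om (H (Y om))%:E = \int[distribution P Y]_x (H x)%:E)%E.
    by rewrite ge0_integral_distribution//; exact/measurable_EFinP.
  rewrite (tr xit) (tr xi).
  by apply: eq_measure_integral => A mA _; exact: xit_law.
apply: ge0_le_integral => //.
- by move=> om _; rewrite lee_fin.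
- by apply/measurable_EFinP; exact: measurableT_comp.
- by have /integrableP[] := hG.1.
- by move=> om _; rewrite lee_fin.
Qed.

End Oracle.

(** * Real recursions with delayed errors *)

Section RealSeries.
Context (R : realType).
Implicit Types (x y eta v a b : nat -> R) (m n t tau : nat).

Lemma ler_sum_nat_widen x m n : (forall t, 0 <= x t) -> (m <= n)%N ->
  \sum_(0 <= t < m) x t <= \sum_(0 <= t < n) x t.
Proof.
by move=> x0 mn; rewrite (big_cat_nat (leq0n m) mn)/= lerDl sumr_ge0.
Qed.

(** Each entry lies in at most tau windows. The induction widens all windows by one entry on the
    left. *)
Lemma sum_window_le x tau n : (forall t, 0 <= x t) ->
  \sum_(0 <= t < n) \sum_(t - tau <= j < t) x j <= tau%:R * \sum_(0 <= t < n) x t.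
Proof.
move=> x0; elim: tau => [|tau IH].
  by rewrite mul0r big1// => t _; rewrite subn0 big_geq.
(* The entry gained by the window of t; windows already truncated at 0 gain nothing. *)
pose z t := if (tau < t)%N then x (t - tau.+1)%N else 0.
have -> : \sum_(0 <= t < n) \sum_(t - tau.+1 <= j < t) x j =
    \sum_(0 <= t < n) \sum_(t - tau <= j < t) x j + \sum_(0 <= t < n) z t.
  rewrite -big_split; apply: eq_bigr => t _; rewrite /z/=.
  case: ifPn => [tt|]; last first.
    rewrite -leqNgt => tt.
    by rewrite addr0; have -> : (t - tau.+1 = t - tau)%N by lia.
  rewrite big_ltn; last by lia.
  by rewrite addrC; have -> : (t - tau.+1).+1 = (t - tau)%N by lia.
have zE : \sum_(0 <= t < n) z t = \sum_(0 <= t < n - tau.+1) x t.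
  elim: n {IH} => [|n IH]; first by rewrite sub0n !big_geq.
  rewrite big_nat_recr//= IH /z; case: ifPn => [tn|].
    have -> : (n.+1 - tau.+1 = (n - tau.+1).+1)%N by lia.
    by rewrite big_nat_recr.
  rewrite -leqNgt => tn; rewrite addr0.
  by have -> : (n.+1 - tau.+1 = n - tau.+1)%N by lia.
rewrite -natr1 mulrDl mul1r lerD// zE ler_sum_nat_widen//.
exact: leq_subr.
Qed.

Lemma small_tail x (B e : R) : (forall t, 0 <= x t) ->
  (forall n, \sum_(0 <= t < n) x t <= B) -> 0 < e ->
  exists T, forall m n, (T <= m)%N -> (m <= n)%N -> \sum_(m <= t < n) x t <= e.
Proof.
move=> x0 xB e0.
pose U := range (fun n => \sum_(0 <= t < n) x t).
have supU : has_sup U.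
  by split; [exists (\sum_(0 <= t < 0) x t); exists 0%N|exists B => _ [n _ <-]].
have [_ [T _ <-] hT] := sup_adherent e0 supU.
exists T => m n Tm mn.
have hn : \sum_(0 <= t < n) x t <= sup U.
  by apply: sup_upper_bound => //; exists n.
have hm := ler_sum_nat_widen x0 Tm.
by move: hn; rewrite (big_cat_nat (leq0n m) mn)/=; lra.
Qed.

(* The term [c * eta t * a t] absorbs all the other occurrences of [a], which
   carry higher powers of the step size. *)
Lemma delayed_recursion_summable (c C K B2 : R) tau eta v a b :
  0 < c -> 0 <= C -> 0 <= K ->
  (forall t, 0 <= eta t) -> (forall s t, (s <= t)%N -> eta t <= eta s) ->
  (forall e : R, 0 < e -> exists T, forall t, (T <= t)%N -> eta t <= e) ->
  (forall n, \sum_(0 <= t < n) eta t ^+ 2 <= B2) ->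
  (forall t, 0 <= v t) -> (forall t, 0 <= a t) -> (forall t, 0 <= b t) ->
  (forall t, v t.+1 + c * eta t * a t <=
    v t + C * eta t ^+ 2 * a t + C * eta t * b t + C * eta t ^+ 2) ->
  (forall t, b t <= K * \sum_(t - tau <= j < t) eta j ^+ 2 * (a j + 1)) ->
  exists B, forall n, \sum_(0 <= t < n) eta t * (a t + b t + eta t) <= B.
Proof.
move=> c0 C0 K0 eta0 eta_dec eta_lim eta2 v0 a0 b0 vrec bK.
pose M := eta 0%N; pose Kt := K * tau%:R * M.
have M0 : 0 <= M by exact: eta0.
have Kt0 : 0 <= Kt by rewrite !mulr_ge0.
pose A1 n := \sum_(0 <= t < n) eta t * a t.
pose A2 n := \sum_(0 <= t < n) eta t ^+ 2 * a t.
pose E2 n := \sum_(0 <= t < n) eta t ^+ 2.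
pose Bn n := \sum_(0 <= t < n) eta t * b t.
have BnE n : Bn n <= Kt * (A2 n + E2 n).
  (* The factor eta t is spent as the constant [M]; the squares left in the window give [A2 + E2]
     once the sums are interchanged. *)
  have h t : eta t * b t <=
      K * \sum_(t - tau <= j < t) M * (eta j ^+ 2 * (a j + 1)).
    rewrite -mulr_sumr mulrCA ler_pM//.
    by apply: eta_dec.
  apply: (le_trans (ler_sum_nat (fun t _ => h t))).
  rewrite -mulr_sumr /Kt -!mulrA ler_wpM2l//.
  apply: (le_trans (sum_window_le _ _ _)).
    by move=> t; rewrite !mulr_ge0// ?sqr_ge0// addr_ge0.
  rewrite -mulr_sumr !mulrA ler_wpM2l ?mulr_ge0//.
  rewrite -big_split/= le_eqVlt; apply/orP; left; apply/eqP/eq_bigr => t _.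
  by rewrite mulrDr mulr1.
have vsum n : v n + c * A1 n <= v 0%N + C * A2 n + C * Bn n + C * E2 n.
  elim: n => [|n IH]; first by rewrite /A1 /A2 /Bn /E2 !big_geq// !mulr0 !addr0.
  rewrite /A1 /A2 /Bn /E2 !big_nat_recr//=.
  have := vrec n; move: IH; rewrite /A1 /A2 /Bn /E2 !mulrDr !mulrA; lra.
(* The coefficient of [A2] and [E2] after substituting [BnE] into [vsum], kept abstract. *)
have [C2 C2E] : exists C2, C2 = C + C * Kt by exists (C + C * Kt).
have C20 : 0 <= C2 by rewrite C2E addr_ge0// mulr_ge0.
(* From T on, half of the negative term pays for [C2] times the terms of [A2]; the earlier ones
   contribute the constant [C2 * A2 T]. *)
have [T hT] : exists T, forall t, (T <= t)%N -> C2 * eta t <= c / 2.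
  have [T hT] := eta_lim _
    (divr_gt0 (divr_gt0 c0 (ltr0n _ 2)) (ltr_wpDl C20 ltr01)).
  exists T => t /hT; rewrite ler_pdivlMr ?ltr_wpDl// => h.
  by have := eta0 t; move: h; rewrite mulrDr mulrC; lra.
have A2E n : C2 * A2 n <= c / 2 * A1 n + C2 * A2 T.
  have c20 : 0 <= c / 2 by rewrite divr_ge0 ?ltW.
  have [Tn|/ltnW nT] := leqP T n; last first.
    have h : A2 n <= A2 T.
      by apply: ler_sum_nat_widen => // t; rewrite mulr_ge0 ?sqr_ge0.
    have := ler_wpM2l C20 h; have : 0 <= c / 2 * A1 n.
      by rewrite mulr_ge0//; apply: sumr_ge0 => t _; rewrite mulr_ge0.
    by lra.
  have h : C2 * \sum_(T <= t < n) eta t ^+ 2 * a t <=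
      c / 2 * \sum_(T <= t < n) eta t * a t.
    rewrite !mulr_sumr; apply: ler_sum_nat => t /andP[Tt _].
    rewrite (_ : C2 * _ = C2 * eta t * (eta t * a t)); last by ring.
    by rewrite ler_wpM2r ?mulr_ge0// hT.
  have : 0 <= c / 2 * A1 T.
    by rewrite mulr_ge0//; apply: sumr_ge0 => t _; rewrite mulr_ge0.
  rewrite /A1 /A2 !(big_cat_nat (leq0n T) Tn)/= !mulrDr.
  by move: h; lra.
have E2B n : E2 n <= B2 by exact: eta2.
(* The remaining half of the negative term is bounded by this numerator. *)
pose B1 := (v 0%N + C2 * A2 T + C2 * B2) / (c / 2).
have A1B n : A1 n <= B1.
  rewrite ler_pdivlMr ?divr_gt0//.
  have := vsum n; have := A2E n; have := BnE n; have := v0 n; have := E2B n.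
  rewrite C2E; nra.
have A2B n : A2 n <= M * B1.
  apply: le_trans (ler_wpM2l M0 (A1B n)).
  rewrite mulr_sumr; apply: ler_sum_nat => t _.
  by rewrite expr2 -!mulrA ler_wpM2r ?mulr_ge0// eta_dec.
exists (B1 + Kt * (M * B1 + B2) + B2) => n.
have -> : \sum_(0 <= t < n) eta t * (a t + b t + eta t) = A1 n + Bn n + E2 n.
  by rewrite -!big_split/=; apply: eq_bigr => t _; rewrite expr2; ring.
rewrite !lerD//; apply: (le_trans (BnE n)).
by rewrite ler_wpM2l// lerD.
Qed.

Lemma recursion_small (B e : R) eta v x : 0 < e ->
  (forall t, 0 <= eta t) -> (forall t, 0 <= v t) -> (forall t, 0 <= x t) ->
  (forall C : R, exists n, C < \sum_(0 <= t < n) eta t) ->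
  (forall n, \sum_(0 <= t < n) eta t * v t <= B) ->
  (forall n, \sum_(0 <= t < n) x t <= B) ->
  forall T0, exists2 T, (T0 <= T)%N &
    v T <= e /\ forall n, \sum_(T <= t < n) x t <= e.
Proof.
move=> e0 eta0 v0 x0 etaoo vB xB T0.
have [T1 hT1] := small_tail x0 xB e0.
pose m := maxn T0 T1.
suff [T mT vT] : exists2 T, (m <= T)%N & v T <= e.
  exists T; first by rewrite (leq_trans _ mT) ?leq_maxl.
  split => // n; have [Tn|nT] := leqP T n; last by rewrite big_geq ?ltW// ltnW.
  by apply: hT1 => //; rewrite (leq_trans _ mT) ?leq_maxr.
apply: contrapT => noT.
have vlarge t : (m <= t)%N -> e <= v t.
  by move=> mt; apply/ltW; rewrite ltNge; apply/negP => vt; apply: noT; exists t.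
(* Beyond m the stepsizes then sum to more than B / e; with v >= e there, the weighted sum would
   exceed [B]. *)
have [n hn] := etaoo (\sum_(0 <= t < m) eta t + B / e).
have B0 : 0 <= B by have := xB 0%N; rewrite big_geq.
have nm : (m <= n)%N.
  rewrite leqNgt; apply/negP => /ltnW nm; move: hn.
  rewrite ltNge => /negP; apply; apply: (le_trans (ler_sum_nat_widen eta0 nm)).
  by rewrite lerDl divr_ge0// ltW.
move: hn; rewrite (big_cat_nat (leq0n m) nm)/= ltrD2l ltr_pdivrMr// => hn.
have := vB n; rewrite leNgt => /negP; apply; apply: (lt_le_trans hn).
rewrite (big_cat_nat (leq0n m) nm)/= mulr_suml.
rewrite -[leLHS]add0r lerD//; first by apply: sumr_ge0 => t _; rewrite mulr_ge0.
by apply: ler_sum_nat => t /andP[mt _]; rewrite ler_wpM2l// vlarge.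
Qed.

End RealSeries.

(** * The stepsizes q / (k + t) *)

Section HarmonicSteps.
Context (R : realType) (q k : R) (eta : nat -> R).
Hypotheses (q_gt0 : 0 < q) (k_gt0 : 0 < k).
Hypothesis etaE : forall t, eta t = q / (k + t%:R).

Let kt_gt0 t : 0 < k + t%:R.
Proof. by rewrite ltr_wpDr. Qed.

Lemma harmonic_step_le s t : (s <= t)%N -> eta t <= eta s.
Proof.
by move=> st; rewrite !etaE ler_pM2l// lef_pV2 ?posrE// lerD2l ler_nat.
Qed.

Lemma harmonic_step_small (e : R) : 0 < e ->
  exists T, forall t, (T <= t)%N -> eta t <= e.
Proof.
move=> e0; exists (Num.truncn (q / e)).+1 => t Tt.
rewrite etaE ler_pdivrMr// mulrC -ler_pdivrMr//.
by have := truncnS_gt (q / e); move: Tt; rewrite -(ler_nat R); have := k_gt0; lra.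
Qed.

Lemma harmonic_step_sqr_sum n :
  \sum_(0 <= t < n) eta t ^+ 2 <= q ^+ 2 * (k ^- 2 + k^-1).
Proof.
(* The first term is k^-2; the others are compared with the telescoping differences 1 / y - 1 / (y +
   1), where y = k + t. *)
suff h : \sum_(0 <= t < n.+1) eta t ^+ 2 <=
    q ^+ 2 * (k ^- 2 + k^-1 - (k + n%:R)^-1).
  apply: (le_trans (ler_sum_nat_widen (fun t => sqr_ge0 (eta t)) (leqnSn n))).
  apply: (le_trans h); by rewrite ler_wpM2l ?sqr_ge0// gerBl invr_ge0 ltW.
elim: n => [|n IH].
  by rewrite big_nat1 etaE addr0 addrK exprMn exprVn.
rewrite big_nat_recr//= etaE exprMn.
apply: (le_trans (lerD IH (lexx _))); rewrite -mulrDr ler_wpM2l ?sqr_ge0//.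
rewrite -addrA lerD2l exprVn -natr1 addrA.
have := kt_gt0 n; set y := k + n%:R => y0.
have y1 : 0 < y + 1 by rewrite ltr_wpDr.
rewrite -subr_ge0 (_ : _ - _ = (y * (y + 1) ^+ 2)^-1); last first.
  by field; rewrite !gt_eqF.
by rewrite invr_ge0 ltW// mulr_gt0// exprn_gt0.
Qed.

Lemma harmonic_step_sum_unbounded (C : R) :
  exists n, C < \sum_(0 <= t < n) eta t.
Proof.
apply: contrapT => bnd.
(* Comparison with the harmonic series, since k + t <= (k + 1) (t + 1). *)
pose r := q / (k + 1).
have r0 : 0 < r by rewrite divr_gt0// ltr_wpDr.
have rh t : r * harmonic t <= eta t.
  rewrite etaE /r -mulrA ler_pM2l// -invfM lef_pV2 ?posrE ?mulr_gt0 ?ltr_wpDr//.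
  rewrite -natr1; have := ler0n R t; have := k_gt0; nra.
apply: (@dvg_harmonic R).
apply: nondecreasing_is_cvgn.
  by apply/nondecreasing_series => n _ _; exact: harmonic_ge0.
exists (C / r) => _ [n _ <-].
rewrite ler_pdivlMr// mulrC /series/= mulr_sumr.
apply: (@le_trans _ _ (\sum_(0 <= t < n) eta t)).
  by apply: ler_sum_nat => t _; exact: rh.
by rewrite leNgt; apply/negP => h; apply: bnd; exists n.
Qed.

End HarmonicSteps.

(** * Almost supermartingales *)

Section MaximalInequality.
Context (dO : measure_display) (Omega : measurableType dO) (R : realType)
  (P : probability Omega R).
Variables (V : nat -> Omega -> R) (x : nat -> R).
Hypothesis V_meas : forall n, measurable_fun setT (V n).
Hypothesis V_ge0 : forall n om, 0 <= V n om.

(** The event that the first time r >= T with V_r >= e is not before n. As n is excluded,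
    [stays_below e T s.+1] is determined by V up to time s. *)
Definition stays_below (e : R) (T n : nat) : set Omega :=
  [set om | forall r, (T <= r < n)%N -> V r om < e].

Lemma stays_below_recr e T n : (T <= n)%N ->
  stays_below e T n.+1 = stays_below e T n `&` [set om | V n om < e].
Proof.
move=> Tn; apply/seteqP; split => [om h|om [h hn] r].
  by split => [r /andP[Tr rn]|]; apply: h; rewrite ?Tr ?Tn/= ?ltnS// ltnW.
move=> /andP[Tr]; rewrite ltnS leq_eqVlt => /orP[/eqP ->//|rn].
by apply: h; rewrite Tr.
Qed.

Lemma measurable_sublevel e n : measurable [set om | V n om < e].
Proof.
rewrite (_ : [set _ | _] = V n @^-1` `]-oo, e[%classic).
  by rewrite -[X in measurable X]setTI; exact: V_meas.
by apply/seteqP; split => om; rewrite /= in_itv.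
Qed.

Lemma measurable_stays_below e T n : measurable (stays_below e T n).
Proof.
elim: n => [|n IH].
  rewrite (_ : stays_below e T 0 = setT); first exact: measurableT.
  by apply/seteqP; split => // om _ r; rewrite ltn0 andbF.
have [Tn|nT] := leqP T n.
  by rewrite stays_below_recr//; apply: measurableI => //; exact: measurable_sublevel.
rewrite (_ : stays_below e T n.+1 = setT); first exact: measurableT.
by apply/seteqP; split => // om _ r; lia.
Qed.

Variables (T0 : nat).
Hypothesis V_rec : forall e T s, (T0 <= s)%N ->
  (\int[P]_(om in stays_below e T s.+1) (V s.+1 om)%:E <=
   \int[P]_(om in stays_below e T s.+1) (V s om)%:E + (x s)%:E)%E.

(** The left side grows by at most x_m from m to m + 1: paths that first reach e at time m leave the
    integral, where they contributed V_m >= e, and enter the probability with weight e. *)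
Lemma maximal_inequality (e : R) T n : 0 <= e -> (T0 <= T)%N -> (T <= n)%N ->
  (\int[P]_(om in stays_below e T n) (V n om)%:E +
     e%:E * P (~` stays_below e T n) <=
   \int[P]_om (V T om)%:E + (\sum_(T <= s < n) x s)%:E)%E.
Proof.
move=> e0 T0T /subnK <-; elim: (n - T)%N => [|l IH].
  rewrite add0n big_geq// (_ : stays_below e T T = setT).
    by rewrite setCT measure0 mule0.
  by apply/seteqP; split => // om _ r; lia.
set m := (l + T)%N in IH *; have Tm : (T <= m)%N by exact: leq_addl.
rewrite addSn big_nat_recr//= EFinD addeA.
apply: le_trans (leeD2r _ IH) => {IH}.
set G := stays_below e T m; set G' := stays_below e T m.+1.
have mG : measurable G by exact: measurable_stays_below.
have mG' : measurable G' by exact: measurable_stays_below.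
have G'G : G' `<=` G by rewrite /G' stays_below_recr// => om [].
have mV r (B : set Omega) : measurable_fun B (fun om => (V r om)%:E).
  by apply: measurable_funTS; apply/measurable_EFinP.
have V0 r om : (0 <= (V r om)%:E)%E by rewrite lee_fin.
have -> : (\int[P]_(om in G) (V m om)%:E = \int[P]_(om in G') (V m om)%:E +
    \int[P]_(om in G `\` G') (V m om)%:E)%E.
  rewrite -ge0_integral_setU//.
  - by rewrite setDUK.
  - exact: measurableD.
  - by rewrite disj_set2E setDIK.
have -> : P (~` G') = (P (~` G) + P (G `\` G'))%E.
  rewrite -measureU//.
  - congr (P _); apply/seteqP; split => om /=; last by move=> [nG /G'G|[]].
    by have [] := pselect (G om); tauto.
  - exact: measurableC.
  - exact: measurableD.
  - by rewrite setIDA setICl set0D.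
have low : (e%:E * P (G `\` G') <= \int[P]_(om in G `\` G') (V m om)%:E)%E.
  rewrite -integral_cst; last exact: measurableD.
  apply: ge0_le_integral => //; first exact: measurableD.
  move=> om []; rewrite /G' stays_below_recr// => Gom nG'.
  by rewrite lee_fin leNgt; apply/negP => h; apply: nG'.
have mT0 : (T0 <= m)%N by exact: leq_trans Tm.
have := V_rec e T mT0; rewrite -/G' => h.
rewrite ge0_muleDr//.
apply: (le_trans (leeD h (leeD (lexx _) low))).
by rewrite (addeC (e%:E * _)%E) [leLHS]addeACA -[leRHS]addeA (addeC (x m)%:E).
Qed.

Hypothesis V_small : forall e : R, 0 < e -> exists2 T, (T0 <= T)%N &
  (\int[P]_om (V T om)%:E <= e%:E)%E /\ forall n, \sum_(T <= s < n) x s <= e.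

Lemma negligible_recurrent_above (e : R) : 0 < e ->
  P (\bigcap_T \bigcup_n ~` stays_below e T n) = 0%E.
Proof.
move=> e0; set N := \bigcap_T _.
have mN : measurable N.
  apply: bigcapT_measurable => T; apply: bigcupT_measurable => n.
  by apply: measurableC; exact: measurable_stays_below.
apply/eqP; rewrite eq_le measure_ge0 andbT; apply/lee_addgt0Pr => r r0.
rewrite add0e.
(* Two halves of r e, divided by the level e, bound the probability by r uniformly in n; continuity
   from below then passes to the union. *)
have [T T0T [VT xT]] := V_small (divr_gt0 (mulr_gt0 r0 e0) (ltr0n _ 2)).
have PB n : (P (~` stays_below e T n) <= r%:E)%E.
  have [nT|Tn] := ltnP n T.
    rewrite (_ : stays_below e T n = setT); first by rewrite setCT measure0 lee_fin ltW.
    by apply/seteqP; split => // om _ s; lia.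
  have := maximal_inequality (ltW e0) T0T Tn.
  have mC : measurable (~` stays_below e T n).
    by apply: measurableC; exact: measurable_stays_below.
  have := xT n; rewrite -lee_fin => xTn.
  move=> /le_trans /(_ (leeD VT xTn)); rewrite -EFinD -splitr => h.
  have I0 : (0 <= \int[P]_(om in stays_below e T n) (V n om)%:E)%E.
    by apply: integral_ge0 => om _; rewrite lee_fin.
  have {}h := le_trans (leeDr _ I0) h.
  rewrite -(fineK (fin_num_measure P _ mC)) in h *.
  by move: h; rewrite -EFinM !lee_fin mulrC ler_pM2r.
apply: (@le_trans _ _ (P (\bigcup_n ~` stays_below e T n))).
  apply: le_measure; rewrite ?inE//.
    apply: bigcupT_measurable => n.
    by apply: measurableC; exact: measurable_stays_below.
  by move=> om /(_ T I).
have nd : nondecreasing_seq (fun n => ~` stays_below e T n).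
  move=> m n mn; apply/subsetPset => om; apply: contra_not => h r0' /andP[Tr rm].
  by apply: h; rewrite Tr (leq_trans rm).
have mB n : measurable (~` stays_below e T n).
  by apply: measurableC; exact: measurable_stays_below.
have cvgP := nondecreasing_cvg_mu (mu := P) mB (bigcupT_measurable _ mB) nd.
rewrite -(cvg_lim _ cvgP)//; apply: lime_le; first by apply/cvg_ex; eexists; exact: cvgP.
exact: nearW.
Qed.

Lemma ae_cvg0_maximal : {ae P, forall om, V n om @[n --> \oo] --> (0 : R)}.
Proof.
pose N := \bigcup_m \bigcap_T \bigcup_n ~` stays_below m.+1%:R^-1 T n.
have mN m : measurable (\bigcap_T \bigcup_n ~` stays_below m.+1%:R^-1 T n).
  apply: bigcapT_measurable => T; apply: bigcupT_measurable => n.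
  by apply: measurableC; exact: measurable_stays_below.
have : P.-negligible N.
  apply: negligible_bigcup => m; apply/negligibleP => //.
  by apply: negligible_recurrent_above; rewrite invr_gt0 ltr0n.
apply: negligibleS => om /= ncv; apply: contrapT => nN; apply: ncv.
have stays m : exists T, forall n, stays_below m.+1%:R^-1 T n om.
    apply: contrapT => h; apply: nN; exists m => // T _; apply: contrapT => h'.
    apply: h; exists T => n; apply: contrapT => h''; apply: h'.
    by exists n.
  apply/cvgrPdist_le => e e0.
  (* This m satisfies 1 / (m + 1) < e. *)
  have [T hT] := stays (Num.truncn e^-1).
  exists T => // n /= Tn; rewrite sub0r normrN ger0_norm//.
  apply: ltW; apply: (lt_trans (hT n.+1 n _)); first by rewrite Tn/=.
  by rewrite -[ltRHS]invrK ltf_pV2 ?posrE ?invr_gt0 ?ltr0n// truncnS_gt.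
Qed.

End MaximalInequality.

(** * The past of the process *)

Section Filtration.
Context (dO dX : measure_display) (Omega : measurableType dO)
  (X : measurableType dX) (R : realType) (P : probability Omega R) (d : nat).
Variables (xi : nat -> {RV P >-> X}) (u : nat -> {RV P >-> nat}).
Variables (tau : nat) (Sigma : nat -> nat -> Omega -> {set 'I_d}).
Hypothesis Sigma_meas : forall (t j : nat) (A : set {set 'I_d}),
  (t - tau <= j < t)%N -> measurable (Sigma t j @^-1` A).

Definition history_gens (t : nat) : set_system Omega :=
  [set E | (exists j (A : set X),
              [/\ (j < t)%N, measurable A & E = xi j @^-1` A])
        \/ (exists j (A : set nat), (j < t)%N /\ E = u j @^-1` A)
        \/ (exists s j (A : set {set 'I_d}),
              [/\ (s <= t)%N, (s - tau <= j < s)%N & E = Sigma s j @^-1` A])].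

(* Omega with the sigma-algebra [history t]: F_t-measurability is
   [measurable_fun] on [past t]. *)
Definition past (t : nat) : measurableType _ :=
  g_sigma_algebraType (history_gens t).

Lemma history_gensS s t : (s <= t)%N -> history_gens s `<=` history_gens t.
Proof.
move=> st E [[j [A [js mA ->]]]|[[j [A [js ->]]]|[r [j [A [rs rj ->]]]]]].
- by left; exists j, A; split => //; exact: leq_trans st.
- by right; left; exists j, A; split => //; exact: leq_trans st.
- by right; right; exists r, j, A; split => //; exact: leq_trans st.
Qed.

Lemma measurable_pastW t (A : set Omega) :
  measurable (A : set (past t)) -> measurable A.
Proof.
apply: smallest_sub; first exact: sigma_algebra_measurable.
move=> E [[j [B [js mB ->]]]|[[j [B [js ->]]]|[r [j [B [rs rj ->]]]]]].
- by rewrite -[X in measurable X]setTI; exact: measurable_funP.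
- by rewrite -[X in measurable X]setTI; exact: measurable_funP.
- exact: Sigma_meas.
Qed.

Lemma measurable_pastS s t (A : set Omega) : (s <= t)%N ->
  measurable (A : set (past s)) -> measurable (A : set (past t)).
Proof. by move=> st; apply: sub_sigma_algebra2; exact: history_gensS. Qed.

Lemma measurable_pastT t : measurable_fun setT (id : Omega -> past t).
Proof. by move=> _ A mA; rewrite setTI; exact: measurable_pastW mA. Qed.

Lemma measurable_past_le s t : (s <= t)%N ->
  measurable_fun setT (id : past t -> past s).
Proof. by move=> st _ A mA; rewrite setTI; exact: measurable_pastS mA. Qed.

Lemma measurable_past_xi j t : (j < t)%N ->
  measurable_fun setT (xi j : past t -> X).
Proof.
move=> jt _ A mA; rewrite setTI; apply: sub_gen_smallest.
by left; exists j, A.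
Qed.

Lemma measurable_past_u j t : (j < t)%N ->
  measurable_fun setT (u j : past t -> nat).
Proof.
move=> jt _ A mA; rewrite setTI; apply: sub_gen_smallest.
by right; left; exists j, A.
Qed.

Lemma measurable_past_mask s j t (A : set {set 'I_d}) :
  (s <= t)%N -> (s - tau <= j < s)%N ->
  measurable (Sigma s j @^-1` A : set (past t)).
Proof.
by move=> st sj; apply: sub_gen_smallest; right; right; exists s, j, A.
Qed.

(** Coordinatewise, the form in which [measurable_grad_param] takes a random point. *)
Definition adapted (t : nat) (v : Omega -> 'cV[R]_d) : Prop :=
  forall i, measurable_fun setT ((fun om => v om i 0) : past t -> R).

Lemma adapted_le s t v : (s <= t)%N -> adapted s v -> adapted t v.
Proof.
by move=> st av i; exact: (measurableT_comp (av i) (measurable_past_le st)).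
Qed.

Lemma adaptedB t v v' : adapted t v -> adapted t v' ->
  adapted t (fun om => v om - v' om).
Proof.
move=> av av' i; rewrite (_ : (fun om => _) = fun om => v om i 0 - v' om i 0).
  exact: (measurable_funB (av i) (av' i)).
by apply/funext => om; rewrite !mxE.
Qed.

Lemma adaptedD t v v' : adapted t v -> adapted t v' ->
  adapted t (fun om => v om + v' om).
Proof.
move=> av av' i; rewrite (_ : (fun om => _) = fun om => v om i 0 + v' om i 0).
  exact: (measurable_funD (av i) (av' i)).
by apply/funext => om; rewrite !mxE.
Qed.

Lemma adapted_cst t c : adapted t (fun=> c).
Proof. by move=> i; exact: measurable_cst. Qed.

Lemma adapted_sum t m n (v : nat -> Omega -> 'cV[R]_d) :
  (forall j, (m <= j < n)%N -> adapted t (v j)) ->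
  adapted t (fun om => \sum_(m <= j < n) v j om).
Proof.
elim: n => [|n IH] av.
  rewrite (_ : (fun om => _) = fun=> 0); first exact: adapted_cst.
  by apply/funext => om; rewrite big_geq.
have [mn|nm] := leqP m n.
  rewrite (_ : (fun om => _) =
      fun om => \sum_(m <= j < n) v j om + v n om); last first.
    by apply/funext => om; rewrite big_nat_recr.
  apply: adaptedD; last by apply: av; rewrite mn/=.
  by apply: IH => j /andP[mj jn]; apply: av; rewrite mj ltnS ltnW.
rewrite (_ : (fun om => _) = fun=> 0); first exact: adapted_cst.
by apply/funext => om; rewrite big_geq.
Qed.

Lemma adapted_measurable_nsq t v : adapted t v ->
  measurable_fun setT ((fun om => nsq (v om)) : past t -> R).
Proof. by move=> av; apply: measurable_sum => i; apply: measurable_funX; exact: av. Qed.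

Lemma measurable_nsq_adapted t v : adapted t v ->
  measurable_fun setT (fun om => nsq (v om)).
Proof.
by move=> /adapted_measurable_nsq h; exact: (measurableT_comp h (@measurable_pastT t)).
Qed.

Hypothesis fresh : forall t,
  independent_classes P (pair_sigma_algebra xi u t) (history xi u Sigma tau t).

Lemma ge0_integral_fresh_le t (A : set Omega)
    (phi : past t * (X * nat) -> R) (Psi : Omega -> R) :
  measurable (A : set (past t)) -> measurable_fun setT phi ->
  measurable_fun setT Psi -> (forall z, 0 <= phi z) ->
  (forall om, (\int[P]_om' (phi (om, (xi t om', u t om')))%:E <= (Psi om)%:E)%E) ->
  (\int[P]_(om in A) (phi (om, (xi t om, u t om)))%:E <=
   \int[P]_(om in A) (Psi om)%:E)%E.
Proof.
move=> mA mphi mPsi phi0 phiPsi.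
have mxu : measurable_fun setT (fun om => (xi t om, u t om)).
  exact: measurable_fun_pair.
have Psi0 om : 0 <= Psi om.
  rewrite -lee_fin; apply: le_trans (phiPsi om).
  by apply: integral_ge0 => om' _; rewrite lee_fin.
pose phiA (z : past t * (X * nat)) := (\1_A z.1 * phi z)%:E.
have restr (g : Omega -> R) :
    (\int[P]_(om in A) (g om)%:E = \int[P]_om (\1_A om * g om)%:E)%E.
  rewrite integral_mkcond; apply: eq_integral => om _.
  by rewrite patchE indicE; case: (om \in A); rewrite ?mul1r ?mul0r.
rewrite !restr.
have m1 : @measurable_fun _ _ (past t) R setT (\1_A) by exact: measurable_indic.
have mphiA : measurable_fun setT phiA.
  apply/measurable_EFinP; apply: measurable_funM => //.
  exact: (measurableT_comp m1 measurable_fst).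
have phiA0 z : (0 <= phiA z)%E by rewrite lee_fin mulr_ge0.
have := @independent_ge0_integral _ _ _ Omega (past t) (X * nat)%type R P
  (mfun_of (@measurable_pastT t)) (mfun_of mxu) phiA _ mphiA phiA0 => /= ->; last first.
  move=> B C mB mC.
  have := @fresh t ((fun om => (xi t om, u t om)) @^-1` C) B.
  rewrite setIC muleC; apply; last exact: mB.
  by exists C => //; rewrite setTI.
apply: ge0_le_integral => //.
- by move=> om _; apply: integral_ge0.
- have h := measurable_fun_integral_freeze (P := P) (mfun_of mxu) mphiA phiA0.
  exact: (measurableT_comp h (@measurable_pastT t)).
- apply/measurable_EFinP; apply: measurable_funM => //; apply: measurable_indic.
  exact: measurable_pastW mA.
- move=> om _; rewrite /phiA/= indicE; case: (om \in A).
    by rewrite mul1r; under eq_integral do rewrite mul1r; exact: phiPsi.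
  by rewrite mul0r; under eq_integral do rewrite mul0r; rewrite integral0.
Qed.

End Filtration.

(** * The Hogwild iterates *)

Section Hogwild.
Context (R : realType) (d : nat) (dO dX : measure_display)
  (Omega : measurableType dO) (X : measurableType dX) (P : probability Omega R).
Variables (xi : {RV P >-> X}) (f : 'cV[R]_d -> X -> R) (F : 'cV[R]_d -> R).
Hypothesis f_diff : forall x v, differentiable (f ^~ x) v.
Hypothesis f_meas : forall v, measurable_fun setT (f v).
Hypothesis grad_int : forall v i,
  integrableRV P (fun om => grad (f ^~ (xi om)) v i 0).
Hypothesis grad_unbiased : forall v i,
  'E_P[fun om => (grad (f ^~ (xi om)) v i 0)%R]%E = (grad F v i 0)%:E.
Variables (mu L : R).
Hypotheses (mu_gt0 : 0 < mu) (L_gt0 : 0 < L).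
Hypothesis F_sc : strongly_convex mu F.
Hypothesis f_smooth : forall x, smooth L (f ^~ x).
Variable wstar : 'cV[R]_d.
Hypothesis wstar_min : unique_minimizer F wstar.
Variables (D : nat) (S : X -> nat -> {set 'I_d}).
Hypothesis D_gt0 : (0 < D)%N.
Hypothesis S_filters : filters f D S.
Hypothesis S_meas : forall n i, measurable [set x | i \in S x n].
Variables (xi_ : nat -> {RV P >-> X}) (u : nat -> {RV P >-> nat}).
Hypothesis xi_law : forall t A, measurable A ->
  distribution P (xi_ t) A = distribution P xi A.
Hypothesis u_unif : forall t, conditionally_uniform P xi_ u (nfilters f D) t.
Variables (tau : nat) (Sigma : nat -> nat -> Omega -> {set 'I_d}).
Hypothesis Sigma_meas : forall (t j : nat) (A : set {set 'I_d}),
  (t - tau <= j < t)%N -> measurable (Sigma t j @^-1` A).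
Hypothesis fresh : forall t,
  independent_classes P (pair_sigma_algebra xi_ u t) (history xi_ u Sigma tau t).
Variables (eta : nat -> R) (w what : nat -> Omega -> 'cV[R]_d) (w0 : 'cV[R]_d).
Hypothesis eta_ge0 : forall t, 0 <= eta t.
Hypothesis w_init : forall om, w 0%N om = w0.
Hypothesis w_rec : hogwild_recursion f D S eta xi_ u w what.
Hypothesis w_delay : consistent_with_delay f D S eta xi_ u w what tau Sigma.

Let step t om := filtered_step f D S eta xi_ u what t om.

Let adapted_next t : adapted xi_ u tau Sigma t (what t) ->
  adapted xi_ u tau Sigma t.+1 (step t).
Proof.
move=> a_what i.
have mz : @measurable_fun _ _ (past xi_ u tau Sigma t.+1)
    (past xi_ u tau Sigma t * (X * nat))%type setT
    (fun om => (om, (xi_ t om, u t om))).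
  apply: measurable_fun_pair; first exact: measurable_past_le.
  by apply: measurable_fun_pair; [exact: measurable_past_xi|exact: measurable_past_u].
exact: (measurableT_comp
  (measurable_filtered_grad f_diff f_meas L_gt0 f_smooth D S_meas (eta t) i a_what) mz).
Qed.

Let adapted_delayed t : (forall s, (s <= t)%N -> adapted xi_ u tau Sigma s (w s)) ->
  (forall j, (j < t)%N -> adapted xi_ u tau Sigma t (step j)) ->
  adapted xi_ u tau Sigma t (what t).
Proof.
move=> a_w a_step.
rewrite (_ : what t = fun om => w (t - tau)%N om -
    \sum_(t - tau <= j < t) mask_mx R (Sigma t j om) *m step j om); last first.
  by apply/funext => om; exact: w_delay.
apply: adaptedB.
  by apply: adapted_le (a_w _ (leq_subr tau t)); exact: leq_subr.
apply: adapted_sum => j jt i.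
rewrite (_ : (fun om => _) =
    fun om => (i \in Sigma t j om)%:R * step j om i 0); last first.
  by apply/funext => om; rewrite mask_mxE.
apply: (@measurable_fun_countable_param _ _ (past xi_ u tau Sigma t) R _ (Sigma t j)
  (fun A om => (i \in A)%:R * step j om i 0)) => A.
  exact: measurable_past_mask.
apply: measurable_funM => //; apply: a_step.
by case/andP: jt.
Qed.

(** Iterates and steps need a joint induction: hat w_t uses earlier steps and the masks of time t,
    which belong to F_t, while step t also uses (xi_t, u_t) and is known at t + 1. *)
Lemma adapted_iterates t :
  (forall s, (s <= t)%N -> adapted xi_ u tau Sigma s (w s)) /\
  (forall j, (j < t)%N -> adapted xi_ u tau Sigma t (step j)).
Proof.
elim: t => [|t [a_w a_step]].
  split => // s; rewrite leqn0 => /eqP ->.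
  rewrite (_ : w 0%N = fun=> w0); first exact: adapted_cst.
  by apply/funext => om; rewrite w_init.
have a_next := adapted_next (adapted_delayed a_w a_step).
split => s; rewrite ?ltnS leq_eqVlt => /orP[/eqP ->|st].
- rewrite (_ : w t.+1 = fun om => w t om - step t om); last first.
    by apply/funext => om; exact: w_rec.
  by apply: adaptedB => //; apply: adapted_le (a_w t _).
- by apply: a_w; rewrite -ltnS.
- exact: a_next.
- by apply: adapted_le (a_step s st).
Qed.

Lemma adapted_w t : adapted xi_ u tau Sigma t (w t).
Proof. exact: (adapted_iterates t).1. Qed.

Lemma adapted_what t : adapted xi_ u tau Sigma t (what t).
Proof. by have [a_w a_step] := adapted_iterates t; exact: adapted_delayed. Qed.

Lemma adapted_step t : adapted xi_ u tau Sigma t.+1 (step t).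
Proof. exact: (adapted_iterates t.+1).2. Qed.

Let V t om := nsq (w t om - wstar).
Let a t om := nsq (what t om - wstar).
Let sg t om := nsq (step t om).
Let lag t om := tau%:R * \sum_(t - tau <= j < t) sg j om.

Lemma telescope_w s t om : (s <= t)%N ->
  w t om = w s om - \sum_(s <= j < t) step j om.
Proof.
move=> /subnK <-; elim: (t - s)%N => [|l IH].
  by rewrite add0n big_geq// subr0.
rewrite addSn big_nat_recr ?leq_addl//= w_rec IH.
by rewrite opprD addrA.
Qed.

(** Both vectors start from w_(t - tau), so they differ by the unread parts of the steps in the
    window, each no longer than its step; Cauchy-Schwarz gives the factor tau. *)
Lemma delay_error t om : nsq (w t om - what t om) <= lag t om.
Proof.
have -> : w t om - what t om = \sum_(t - tau <= j < t)
    (mask_mx R (Sigma t j om) *m step j om - step j om).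
  rewrite w_delay (telescope_w om (leq_subr tau t)) sumrB opprB addrC addrA.
  by rewrite subrK.
apply: (le_trans (nsq_sum_le _ _ _)).
rewrite /lag ler_pM ?ler0n ?sumr_ge0//.
- by move=> j _; exact: nsq_ge0.
- by rewrite ler_nat; lia.
- by apply: ler_sum_nat => j _; exact: nsq_mask_sub_le.
Qed.

(** * One-step bounds along the process and their means *)

Variable N : R.
Hypothesis N_ge0 : 0 <= N.
Hypothesis noise : has_mean P (fun om => nsq (grad (f ^~ (xi om)) wstar)) N.

Let adapted_const t c : adapted xi_ u tau Sigma t (fun=> c).
Proof. exact: adapted_cst. Qed.

Let sg_bound t om := eta t ^+ 2 * D%:R * (2 * L ^+ 2 * a t om + 2 * N).
Let V_bound t om := V t om - eta t * (mu / 2 * a t om) +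
  eta t * (2 * L ^+ 2 / mu * lag t om) + sg_bound t om.

Let measurable_past_nsq_update t (p : Omega -> 'cV[R]_d) :
  adapted xi_ u tau Sigma t p ->
  measurable_fun setT (fun z : past xi_ u tau Sigma t * (X * nat) =>
    nsq (p z.1 - filtered_grad f D S (eta t) (what t z.1) z.2)).
Proof.
move=> a_p; apply: measurable_sum => i; apply: measurable_funX.
rewrite (_ : (fun z => _) = fun z : past xi_ u tau Sigma t * (X * nat) =>
    p z.1 i 0 - filtered_grad f D S (eta t) (what t z.1) z.2 i 0); last first.
  by apply/funext => z; rewrite !mxE.
apply: measurable_funB; first exact: (measurableT_comp (a_p i) measurable_fst).
exact: (measurable_filtered_grad f_diff f_meas L_gt0 f_smooth D S_meas
  (eta t) i (@adapted_what t)).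
Qed.

Let lag_ge0 t om : 0 <= lag t om.
Proof. by rewrite mulr_ge0 ?sumr_ge0// => j _; exact: nsq_ge0. Qed.

Let measurable_V t : measurable_fun setT (V t).
Proof.
apply: (measurable_nsq_adapted Sigma_meas (t := t)).
by apply: adaptedB; [exact: adapted_w|exact: adapted_cst].
Qed.

Let measurable_a t : measurable_fun setT (a t).
Proof.
apply: (measurable_nsq_adapted Sigma_meas (t := t)).
by apply: adaptedB; [exact: adapted_what|exact: adapted_cst].
Qed.

Let measurable_sg t : measurable_fun setT (sg t).
Proof. exact: (measurable_nsq_adapted Sigma_meas (@adapted_step t)). Qed.

Let measurable_lag t : measurable_fun setT (lag t).
Proof. by apply: measurable_funM => //; exact: measurable_sum. Qed.

Let measurable_sg_bound t : measurable_fun setT (sg_bound t).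
Proof.
apply: measurable_funM => //; apply: measurable_funD => //.
exact: measurable_funM.
Qed.

Let measurable_V_bound t : measurable_fun setT (V_bound t).
Proof.
apply: measurable_funD => //; apply: measurable_funD.
  by apply: measurable_funB => //; apply: measurable_funM => //; exact: measurable_funM.
by apply: measurable_funM => //; exact: measurable_funM.
Qed.

Lemma integral_sg_le t :
  (\int[P]_om (sg t om)%:E <= \int[P]_om (sg_bound t om)%:E)%E.
Proof.
have -> : (\int[P]_om (sg t om)%:E = \int[P]_om (nsq (0 -
    filtered_grad f D S (eta t) (what t om) (xi_ t om, u t om)))%:E)%E.
  by apply: eq_integral => om _; rewrite sub0r nsqN.
apply: (ge0_integral_fresh_le Sigma_meas fresh _
  (measurable_past_nsq_update (@adapted_const t 0))) => //.
- by move=> z; exact: nsq_ge0.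
- move=> om; apply: le_trans (ge0_integral_filtered_grad_le f_diff f_meas grad_int
    grad_unbiased L_gt0 f_smooth D_gt0 S_filters S_meas (eta t) 0 (what t om)
    (xi_law t) (u_unif t) noise) _.
  by rewrite nsq0 innerC inner0r mulr0 subr0 add0r.
Qed.

(** A free majorant [Psi] serves both the recursion for the means and the almost supermartingale
    inequality, where the drift has been absorbed. *)
Lemma integral_V_le t (A : set Omega) (Psi : Omega -> R) :
  measurable (A : set (past xi_ u tau Sigma t)) ->
  measurable_fun setT Psi -> (forall om, V_bound t om <= Psi om) ->
  (\int[P]_(om in A) (V t.+1 om)%:E <= \int[P]_(om in A) (Psi om)%:E)%E.
Proof.
move=> mA mPsi VPsi.
have -> : (\int[P]_(om in A) (V t.+1 om)%:E = \int[P]_(om in A)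
    (nsq (w t om - wstar - filtered_grad f D S (eta t) (what t om)
      (xi_ t om, u t om)))%:E)%E.
  by apply: eq_integral => om _; rewrite /V w_rec addrAC.
apply: (ge0_integral_fresh_le Sigma_meas fresh mA
  (measurable_past_nsq_update (adaptedB (@adapted_w t) (@adapted_const t wstar)))) => //.
- by move=> z; exact: nsq_ge0.
- move=> om; apply: le_trans (ge0_integral_filtered_grad_le f_diff f_meas grad_int
    grad_unbiased L_gt0 f_smooth D_gt0 S_filters S_meas (eta t) (w t om - wstar)
    (what t om) (xi_law t) (u_unif t) noise) _.
  rewrite lee_fin; apply: le_trans (VPsi om).
  rewrite lerD2r -addrA lerD2l.
  have h := ler_wpM2l (eta_ge0 t) (delayed_descent grad_int grad_unbiased L_gt0 F_sc
    f_smooth wstar_min mu_gt0 (what t om) (w t om)).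
  apply: (@le_trans _ _ (eta t * (- (mu / 2 * a t om) +
      2 * L ^+ 2 / mu * nsq (w t om - what t om)))).
    by apply: le_trans h; rewrite le_eqVlt; apply/orP; left; apply/eqP; ring.
  rewrite mulrDr mulrN lerD2l ler_wpM2l// ler_wpM2l ?delay_error//.
  by apply: divr_ge0; [rewrite mulr_ge0 ?sqr_ge0|exact: ltW].
Qed.

(** As [fine] sends infinite values to 0, this number is meaningful only together with
    [has_mean]. *)
Let mean (Y : Omega -> R) := fine (\int[P]_om (Y om)%:E)%E.

Let has_mean_mean Y : (exists c, has_mean P Y c) -> has_mean P Y (mean Y).
Proof. by move=> [c [iY EY]]; rewrite /mean EY. Qed.

Let lag_mean t (s : nat -> R) : (forall j, (j < t)%N -> has_mean P (sg j) (s j)) ->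
  has_mean P (lag t) (tau%:R * \sum_(t - tau <= j < t) s j).
Proof.
move=> hs; apply: has_meanZ; apply: has_mean_sum => j.
by rewrite mem_index_iota => /andP[_]; exact: hs.
Qed.

Let sg_bound_mean t c : has_mean P (a t) c ->
  has_mean P (sg_bound t) (eta t ^+ 2 * D%:R * (2 * L ^+ 2 * c + 2 * N)).
Proof.
by move=> ha; apply/has_meanZ/has_meanD; [exact: has_meanZ|exact: has_mean_cst].
Qed.

Let a_mean t c b : has_mean P (V t) c -> has_mean P (lag t) b ->
  exists e, has_mean P (a t) e.
Proof.
move=> hV hlag.
apply: (has_mean_dominated _ _ (has_meanD (has_meanZ 2 hV) (has_meanZ 2 hlag))) => // om.
rewrite nsq_ge0/= /a (_ : what t om - wstar = (w t om - wstar) - (w t om - what t om)).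
  rewrite (le_trans (nsqD_le _ _))// lerD2l nsqN ler_wpM2l// delay_error//.
by rewrite opprB [RHS]addrC addrA subrK.
Qed.

(** Finiteness passes from V_t and the earlier increments to the lag, then to a_t, to the increment
    at t, and to V_(t+1), at each stage by domination or by the one-step bound. *)
Let moments t : (exists c, has_mean P (V t) c) /\
  (forall j, (j < t)%N -> exists c, has_mean P (sg j) c).
Proof.
elim: t => [|t [hV hsg]].
  split => //; exists (nsq (w0 - wstar)).
  rewrite (_ : V 0%N = cst (nsq (w0 - wstar))); first exact: has_mean_cst.
  by apply/funext => om; rewrite /V w_init.
have [c hVc] := hV.
have hlag := lag_mean (fun j jt => has_mean_mean (hsg j jt)).
have [b ha] := a_mean hVc hlag.
have hb := sg_bound_mean ha.
have [e hsgt] : exists e, has_mean P (sg t) e.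
  have := integral_sg_le t; rewrite hb.2 => le_sg.
  have [e _ he] := has_mean_bounded (measurable_sg t) (fun om => nsq_ge0 _) le_sg.
  by exists e.
split; last first.
  by move=> j; rewrite ltnS leq_eqVlt => /orP[/eqP ->|/hsg//]; exists e.
apply: (has_mean_dominated _ _ (has_meanD (has_meanZ 2 hVc) (has_meanZ 2 hsgt))) => // om.
rewrite nsq_ge0/= /V w_rec addrAC (le_trans (nsqD_le _ _))// nsqN.
by rewrite lerD2l.
Qed.

Let V_mean t := has_mean_mean (moments t).1.
Let sg_mean t := has_mean_mean ((moments t.+1).2 t (ltnSn t)).
Let v t := mean (V t).
Let b t := tau%:R * \sum_(t - tau <= j < t) mean (sg j).
Let al t := mean (a t).

Let lag_mean_b t : has_mean P (lag t) (b t).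
Proof. by apply: lag_mean => j _; exact: sg_mean. Qed.

Let a_mean_al t : has_mean P (a t) (al t).
Proof. exact: has_mean_mean (a_mean (V_mean t) (lag_mean_b t)). Qed.

Let mean_ge0 Y c : has_mean P Y c -> (forall om, 0 <= Y om) -> 0 <= c.
Proof. by move=> hY Y0; exact: (has_mean_le (has_mean_cst P 0) hY). Qed.

Lemma mean_V_rec t : v t.+1 <= v t - eta t * (mu / 2 * al t) +
  eta t * (2 * L ^+ 2 / mu * b t) + eta t ^+ 2 * D%:R * (2 * L ^+ 2 * al t + 2 * N).
Proof.
have hB : has_mean P (V_bound t) (v t + - eta t * (mu / 2 * al t) +
    eta t * (2 * L ^+ 2 / mu * b t) +
    eta t ^+ 2 * D%:R * (2 * L ^+ 2 * al t + 2 * N)).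
  rewrite (_ : V_bound t = fun om => V t om + - eta t * (mu / 2 * a t om) +
      eta t * (2 * L ^+ 2 / mu * lag t om) + sg_bound t om).
    apply: has_meanD; last exact: sg_bound_mean.
    apply: has_meanD; last by do 2 apply: has_meanZ.
    by apply: has_meanD => //; do 2 apply: has_meanZ.
  by apply/funext => om; rewrite mulNr.
rewrite -mulNr -lee_fin -(V_mean t.+1).2 -hB.2.
by apply: integral_V_le => //; exact: measurableT.
Qed.

Lemma mean_sg_le t :
  mean (sg t) <= eta t ^+ 2 * D%:R * (2 * L ^+ 2 * al t + 2 * N).
Proof.
rewrite -lee_fin -(sg_mean t).2 -(sg_bound_mean (a_mean_al t)).2.
exact: integral_sg_le.
Qed.

(** Transfers the summability obtained for the read vectors to the iterates. *)
Lemma mean_V_le t : v t <= 2 * al t + 2 * b t.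
Proof.
apply: (has_mean_le (V_mean t)
  (has_meanD (has_meanZ 2 (a_mean_al t)) (has_meanZ 2 (lag_mean_b t)))) => om.
rewrite /V (_ : w t om - wstar = (what t om - wstar) + (w t om - what t om)).
  rewrite (le_trans (nsqD_le _ _))// lerD2l ler_wpM2l// delay_error//.
by rewrite [RHS]addrC addrA subrK.
Qed.

Let al_ge0 t : 0 <= al t.
Proof. by apply: mean_ge0 (a_mean_al t) _ => om; exact: nsq_ge0. Qed.

Let v_ge0 t : 0 <= v t.
Proof. by apply: mean_ge0 (V_mean t) _ => om; exact: nsq_ge0. Qed.

Let b_ge0 t : 0 <= b t.
Proof. exact: mean_ge0 (lag_mean_b t) _. Qed.

Let past_stays_below e T s :
  measurable (stays_below V e T s.+1 : set (past xi_ u tau Sigma s)).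
Proof.
(* Only the iterates up to time s are measurable with respect to the past. *)
pose V' r (om : Omega) : R := if (r <= s)%N then V r om else 0.
have -> : stays_below V e T s.+1 = stays_below V' e T s.+1.
  by apply/seteqP; split => om h r /[dup] /andP[_]; rewrite ltnS => rs /h; rewrite /V' rs.
apply: (@measurable_stays_below _ (past xi_ u tau Sigma s)) => r; rewrite /V'.
case: (boolP (r <= s)%N) => rs; last exact: measurable_cst.
apply: adapted_measurable_nsq; apply: adapted_le rs _.
by apply: adaptedB; [exact: adapted_w|exact: adapted_const].
Qed.

(** * Summability and almost sure convergence *)

Variable B2 : R.
Hypothesis eta_dec : forall s t, (s <= t)%N -> eta t <= eta s.
Hypothesis eta_small : forall e : R, 0 < e ->
  exists T, forall t, (T <= t)%N -> eta t <= e.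
Hypothesis eta_sqr_sum : forall n, \sum_(0 <= t < n) eta t ^+ 2 <= B2.
Hypothesis eta_sum : forall C : R, exists n, C < \sum_(0 <= t < n) eta t.

(** Coefficients of the delay error ([k1]), of the noise proportional to a_t ([k2]) and of the noise
    at [wstar] ([k3]). *)
Let k1 := 2 * L ^+ 2 / mu.
Let k2 := D%:R * (2 * L ^+ 2).
Let k3 := D%:R * (2 * N).

Let k1_ge0 : 0 <= k1.
Proof. by apply: divr_ge0; [rewrite mulr_ge0 ?sqr_ge0|exact: ltW]. Qed.

Let k2_ge0 : 0 <= k2.
Proof. by rewrite /k2 mulr_ge0// mulr_ge0 ?sqr_ge0. Qed.

Let k3_ge0 : 0 <= k3.
Proof. by rewrite /k3 mulr_ge0// mulr_ge0. Qed.

Let moments_summable :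
  exists B, forall n, \sum_(0 <= t < n) eta t * (al t + b t + eta t) <= B.
Proof.
apply: (@delayed_recursion_summable R (mu / 2) (k1 + k2 + k3)
  (tau%:R * (k2 + k3)) B2 tau eta v al b) => //.
- by rewrite divr_gt0.
- by rewrite !addr_ge0.
- by rewrite mulr_ge0 ?addr_ge0.
- move=> t; have := mean_V_rec t; rewrite -/k1.
  (* Surplus created by using the single constant [k1 + k2 + k3] for all three error terms; likewise
     [h2] and [h3]. *)
  have h1 : 0 <= eta t * b t * (k2 + k3).
    by apply: mulr_ge0; [exact: mulr_ge0|exact: addr_ge0].
  have e2 : 0 <= eta t ^+ 2 by exact: sqr_ge0.
  have h2 : 0 <= eta t ^+ 2 * al t * (k1 + k3).
    by apply: mulr_ge0; [exact: mulr_ge0|exact: addr_ge0].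
  have h3 : 0 <= eta t ^+ 2 * (k1 + k2) by apply: mulr_ge0 => //; exact: addr_ge0.
  have -> : eta t ^+ 2 * D%:R * (2 * L ^+ 2 * al t + 2 * N) =
    eta t ^+ 2 * al t * k2 + eta t ^+ 2 * k3 by rewrite /k2 /k3; ring.
  by move: h1 h2 h3; lra.
- move=> t; rewrite /b -mulrA ler_wpM2l// mulr_sumr; apply: ler_sum_nat => j _.
  apply: (le_trans (mean_sg_le j)).
  rewrite -[leLHS]mulrA [leRHS]mulrCA ler_wpM2l ?sqr_ge0//.
  have h1 : 0 <= k3 * al j by rewrite mulr_ge0.
  have -> : D%:R * (2 * L ^+ 2 * al j + 2 * N) = k2 * al j + k3.
    by rewrite /k2 /k3; ring.
  by move: h1 k2_ge0; lra.
Qed.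

Lemma ae_cvg_nsq : {ae P, forall om, V t om @[t --> \oo] --> (0 : R)}.
Proof.
have [B hB] := moments_summable.
(* From [T0] on the drift dominates the noise proportional to a_t, which leaves V_t plus the
   perturbation [eps]. *)
have [T0 hT0] : exists T0, forall t, (T0 <= t)%N -> eta t * k2 <= mu / 2.
  have k20 : 0 < k2 + 1 by rewrite ltr_wpDl.
  have [T hT] := eta_small (divr_gt0 (divr_gt0 mu_gt0 (ltr0n _ 2)) k20).
  exists T => t /hT; rewrite ler_pdivlMr// mulrDr mulr1.
  by apply: le_trans; rewrite lerDl.
pose eps t om := eta t * (k1 * lag t om) + eta t ^+ 2 * k3.
pose x t := eta t * (k1 * b t) + eta t ^+ 2 * k3.
have eps_ge0 t om : 0 <= eps t om.
  apply: addr_ge0; first by rewrite mulr_ge0// mulr_ge0.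
  by rewrite mulr_ge0 ?sqr_ge0.
have eps_mean t : has_mean P (eps t) (x t).
  by apply: has_meanD; [do 2 apply: has_meanZ|exact: has_mean_cst].
have x_ge0 t : 0 <= x t by exact: mean_ge0 (eps_mean t) _.
apply: (@ae_cvg0_maximal _ _ _ P V x _ _ T0) => //.
- by move=> t om; exact: nsq_ge0.
- move=> e T s T0s; set A := stays_below _ _ _ _.
  have mpA : measurable (A : set (past xi_ u tau Sigma s)) by exact: past_stays_below.
  have mA : measurable A by exact: (measurable_pastW Sigma_meas mpA).
  have meps : measurable_fun setT (EFin \o eps s).
    by have /integrableP[] := (eps_mean s).1.
  rewrite -(eps_mean s).2.
  apply: (@le_trans _ _ (\int[P]_(om in A) ((V s om)%:E + (eps s om)%:E))%E).
    apply: (integral_V_le (Psi := fun om => V s om + eps s om)) => // [|om].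
      by apply: measurable_funD => //; exact/measurable_EFinP.
    have ha : 0 <= eta s * a s om by rewrite mulr_ge0// nsq_ge0.
    have := ler_wpM2r ha (hT0 s T0s).
    have -> : V_bound s om = V s om + eps s om +
        (eta s * k2 * (eta s * a s om) - mu / 2 * (eta s * a s om)).
      by rewrite /V_bound /eps /sg_bound /k1 /k2 /k3; ring.
    by rewrite gerDl subr_le0.
  rewrite ge0_integralD//.
  (* The integral of [eps] is enlarged to the whole space, where its value is [x s]. *)
  + rewrite leeD2l//; apply: ge0_subset_integral => //.
    by move=> om _; rewrite lee_fin.
  + by move=> om _; rewrite lee_fin nsq_ge0.
  + by apply: measurable_funTS; exact/measurable_EFinP.
  + by move=> om _; rewrite lee_fin.
  + exact: measurable_funTS.
- move=> e e0.
  (* The constant 2 + (k1 + k3) covers both E V_t <= 2 al + 2 b and the terms k1 b + eta k3 of the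
     perturbation. *)
  have C0 : 0 <= k1 + k3 by rewrite addr_ge0.
  have term t y : y <= (2 + (k1 + k3)) * (al t + b t + eta t) ->
      eta t * y <= (2 + (k1 + k3)) * (eta t * (al t + b t + eta t)).
    by rewrite mulrCA => h; rewrite ler_wpM2l.
  have sumB y : (forall t, y t <= (2 + (k1 + k3)) * (al t + b t + eta t)) ->
      forall n, \sum_(0 <= t < n) eta t * y t <= (2 + (k1 + k3)) * B.
    move=> hy n; apply: (@le_trans _ _
      ((2 + (k1 + k3)) * \sum_(0 <= t < n) eta t * (al t + b t + eta t))).
      by rewrite mulr_sumr; apply: ler_sum_nat => t _; exact: term.
    by rewrite ler_wpM2l// addr_ge0.
  have vB := sumB v; have xB := sumB (fun t => k1 * b t + eta t * k3).
  have [||T T0T [vT xT]] := @recursion_small R ((2 + (k1 + k3)) * B) e eta v x e0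
    eta_ge0 v_ge0 x_ge0 eta_sum _ _ T0.
  + apply: vB => t; apply: (le_trans (mean_V_le t)).
    have h1 : 0 <= (k1 + k3) * (al t + b t + eta t) by rewrite mulr_ge0 ?addr_ge0.
    by have := eta_ge0 t; move: h1; lra.
  + move=> n; rewrite (_ : \sum_(0 <= t < n) x t =
        \sum_(0 <= t < n) eta t * (k1 * b t + eta t * k3)).
      apply: xB => t.
      have h1 : 0 <= k1 * (al t + eta t) by rewrite mulr_ge0 ?addr_ge0.
      have h2 : 0 <= k3 * (al t + b t) by rewrite mulr_ge0 ?addr_ge0.
      have := eta_ge0 t; have := b_ge0 t; have := al_ge0 t.
      by move: h1 h2; lra.
    by apply: eq_bigr => t _; rewrite /x; ring.
  exists T => //; split => //.
  by rewrite (V_mean T).2 lee_fin.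
Qed.

End Hogwild.

Theorem theorem8 (R : realType) (d : nat)
  (dO dX : measure_display) (Omega : measurableType dO) (X : measurableType dX)
  (P : probability Omega R)
  (* the problem *)
  (xi : {RV P >-> X}) (f : 'cV[R]_d -> X -> R) (F : 'cV[R]_d -> R)
  (f_diff : forall (x : X) (v : 'cV[R]_d), differentiable (f ^~ x) v)
  (f_meas : forall v : 'cV[R]_d, measurable_fun setT (f v))
  (f_int : forall v : 'cV[R]_d, integrableRV P (fun om => f v (xi om)))
  (FE : forall v : 'cV[R]_d, 'E_P[fun om => f v (xi om)]%E = (F v)%:E)
  (F_diff : forall v : 'cV[R]_d, differentiable F v)
  (grad_int : forall (v : 'cV[R]_d) (i : 'I_d),
    integrableRV P (fun om => grad (f ^~ (xi om)) v i 0))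
  (grad_unbiased : forall (v : 'cV[R]_d) (i : 'I_d),
    'E_P[fun om => (grad (f ^~ (xi om)) v i 0)%R]%E = (grad F v i 0)%:E)
  (mu L : R) (mu_gt0 : 0 < mu) (L_gt0 : 0 < L)
  (F_sc : strongly_convex mu F)
  (f_smooth : forall x : X, smooth L (f ^~ x))
  (wstar : 'cV[R]_d) (wstar_min : unique_minimizer F wstar)
  (N_fin : (2%:E * 'E_P[fun om => (enorm (grad (f ^~ (xi om)) wstar) ^+ 2)%R]
            < +oo)%E)
  (* the filters *)
  (D : nat) (D_gt0 : (0 < D)%N) (S : X -> nat -> {set 'I_d})
  (S_filters : filters f D S)
  (S_meas : forall (n : nat) (i : 'I_d), measurable [set x : X | i \in S x n])
  (* the randomness *)
  (xi_ : nat -> {RV P >-> X}) (u : nat -> {RV P >-> nat})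
  (xi_law : forall (t : nat) (A : set X), measurable A ->
    distribution P (xi_ t) A = distribution P xi A)
  (xi_indep : mutually_independent P xi_)
  (u_unif : forall t : nat, conditionally_uniform P xi_ u (nfilters f D) t)
  (tau : nat) (Sigma : nat -> nat -> Omega -> {set 'I_d})
  (Sigma_meas : forall (t j : nat) (A : set {set 'I_d}),
    (t - tau <= j < t)%N -> measurable (Sigma t j @^-1` A))
  (fresh : forall t : nat, independent_classes P
    (pair_sigma_algebra xi_ u t) (history xi_ u Sigma tau t))
  (* the algorithm *)
  (beta k : R) (beta_gt0 : 0 < beta) (k_ge : 3 * tau%:R <= k)
  (eta : nat -> R) (eta_gt0 : forall t : nat, 0 < eta t)
  (etaE : forall t : nat,
    eta t = 1 / (L * D%:R * (L / mu) * (2 + beta) * (k + t%:R)))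
  (w what : nat -> Omega -> 'cV[R]_d) (w0 : 'cV[R]_d)
  (w_init : forall om, w 0%N om = w0)
  (w_rec : hogwild_recursion f D S eta xi_ u w what)
  (w_delay : consistent_with_delay f D S eta xi_ u w what tau Sigma) :
  {ae P, forall om, enorm (w t om - wstar) @[t --> \oo] --> (0 : R)}.
Proof.
have [N N0 noise] := has_mean_noise f_diff f_meas N_fin.
pose q := 1 / (L * D%:R * (L / mu) * (2 + beta)).
have q_gt0 : 0 < q.
  rewrite divr_gt0// !mulr_gt0 ?ltr0n ?invr_gt0//.
  by rewrite addr_gt0.
have eta_q t : eta t = q / (k + t%:R) by rewrite etaE /q !div1r invfM.
(* The value k = 0 is excluded by eta 0 > 0, since the inverse of 0 is 0. *)
have k_gt0 : 0 < k.
  rewrite lt_neqAle (le_trans _ k_ge) ?mulr_ge0// andbT; apply/eqP => k0.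
  by have := eta_gt0 0%N; rewrite eta_q -k0 addr0 invr0 mulr0 ltxx.
have eta_ge0 t : 0 <= eta t by exact: ltW.
have cvgV := ae_cvg_nsq f_diff f_meas grad_int grad_unbiased mu_gt0 L_gt0 F_sc
  f_smooth wstar_min D_gt0 S_filters S_meas xi_law u_unif Sigma_meas fresh eta_ge0
  w_init w_rec w_delay N0 noise (harmonic_step_le q_gt0 k_gt0 eta_q)
  (harmonic_step_small k_gt0 eta_q) (harmonic_step_sqr_sum k_gt0 eta_q)
  (harmonic_step_sum_unbounded q_gt0 k_gt0 eta_q).
apply: filterS cvgV => om /= V0.
rewrite -[X in _ --> X](sqrtr0 R).
by apply: continuous_cvg => //; exact: sqrt_continuous.
Qed.
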